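(* Suppose the weighted composition operators $C_{\phi_1,\omega_1}$ and $C_{\phi_2,\omega_2}$ in $L^2(\mu)$ are densely defined, and fix $\lambda\in\{0,1\}$. Then $\mathcal{M}_\lambda(\mathbf{C}_{\phi,\omega})=(C_{\phi_1,\omega_\lambda^1},C_{\phi_2,\omega_\lambda^2})$ if and only if there is $c\in(0,\infty)$ such that $$1+\sum_{i=1}^2h_{\phi_i,\omega_i}+\sum_{i=1}^2\mathsf{E}_i\ \le\ c\Big(1+\lambda\sum_{i=1}^2h_{\phi_i,\omega_i}+(1-\lambda)\sum_{i=1}^2\mathsf{E}_i\Big)\quad\text{a.e. }[\mu].$$
   Context: $(X,\mathscr{A},\mu)$ is a $\sigma$-finite measure space and $L^2(\mu)$ is the complex Hilbert space. For an $\mathscr{A}$-measurable transformation $\phi:X\to X$ and an $\mathscr{A}$-measurable $\omega:X\to\mathbb{C}$, put $\mu_\omega(\Delta)=\int_\Delta|\omega|^2d\mu$. The weighted composition operator $C_{\phi,\omega}$ in $L^2(\mu)$ has domain $\mathcal{D}(C_{\phi,\omega})=\{f\in L^2(\mu):\omega\cdot(f\circ\phi)\in L^2(\mu)\}$ and acts by $C_{\phi,\omega}f=\omega\cdot(f\circ\phi)$. It is always assumed that $\mu_\omega\circ\phi^{-1}\ll\mu$ (so $C_{\phi,\omega}$ is well-defined); this is automatic for $C_{\phi_i,\omega^i_\lambda}$ below. $h_{\phi,\omega}:X\to[0,\infty]$ is the ($\mu$-a.e. unique) measurable function with $\mu_\omega(\phi^{-1}(\Delta))=\int_\Delta h_{\phi,\omega}\,d\mu$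 for all $\Delta\in\mathscr{A}$. If $C_{\phi,\omega}$ is densely defined, then $\mu_\omega|_{\phi^{-1}(\mathscr{A})}$ is $\sigma$-finite, and for measurable $f:X\to[0,\infty]$, $E_{\phi,\omega}(f)$ is the ($\mu_\omega$-a.e. unique) $\phi^{-1}(\mathscr{A})$-measurable $[0,\infty]$-valued function with $\int_{\phi^{-1}(\Delta)}f\,d\mu_\omega=\int_{\phi^{-1}(\Delta)}E_{\phi,\omega}(f)\,d\mu_\omega$ for all $\Delta\in\mathscr{A}$. $E_{\phi,\omega}(f)\circ\phi^{-1}$ denotes the ($\mu$-a.e. unique) $\mathscr{A}$-measurable function on $X$ that vanishes $\mu$-a.e. on $\{h_{\phi,\omega}=0\}$ and satisfies $(E_{\phi,\omega}(f)\circ\phi^{-1})\circ\phi=E_{\phi,\omega}(f)$ a.e. $[\mu_\omega]$. A pair $(T_1,T_2)$ of operators in $L^2(\mu)$ is identified with the column operator $f\mapsto\binom{T_1f}{T_2f}$ with domain $\mathcal{D}(T_1)\cap\mathcal{D}(T_2)$; equality of pairs means equality of these operators (including domains). If $C_{\phi_1,\omega_1},C_{\phi_2,\omega_2}$ are densely defined, the column operator $\mathbf{C}_{\phi,\omega}=(C_{\phi_1,\omega_1},C_{\phi_2,\omega_2})$ is densely defined and closed; let $\mathbf{C}_{\phi,\omega}=\binom{U_1}{U_2}|\mathbf{C}_{\phi,\omega}|$ be its polar decomposition. The $\lambda$-spherical mean transform is $$\mathcal{M}_\lambda(\mathbf{C}_{\phi,\omega})=\big(\lambda U_1|\mathbf{C}_{\phi,\omega}|+(1-\lambda)|\mathbf{C}_{\phi,\omega}|U_1,\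 \lambda U_2|\mathbf{C}_{\phi,\omega}|+(1-\lambda)|\mathbf{C}_{\phi,\omega}|U_2\big),$$ where for every $\lambda\in[0,1]$ (including the endpoints) the $i$th component has domain $\mathcal{D}(U_i|\mathbf{C}_{\phi,\omega}|)\cap\mathcal{D}(|\mathbf{C}_{\phi,\omega}|U_i)$. With $H=h_{\phi_1,\omega_1}+h_{\phi_2,\omega_2}$: $\mathsf{E}_i=\big(E_{\phi_i,\omega_i}(H)\circ\phi_i^{-1}\big)\cdot\dfrac{h_{\phi_i,\omega_i}\,\chi_{\{H>0\}}}{H}$ (a $[0,\infty]$-valued function, equal to $0$ where $H=0$; convention $0\cdot\infty=0$), and $\omega_\lambda^i=(\eta_i+\lambda(1-\eta_i))\,\omega_i$ a.e. $[\mu]$ with $\eta_i=\chi_{\{\omega_i\neq0\}}\big(\frac{H}{H\circ\phi_i}\big)^{1/2}$ (meaningful since $\mu(\{\omega_i\ne0\}\cap\{H\circ\phi_i=0\})=0$). *)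

(* Defs.v *)
From HB Require Import structures.
From mathcomp Require Import all_boot all_order all_algebra.
From mathcomp Require Import complex.
From mathcomp Require Import ring.
From mathcomp Require Import all_classical all_reals all_analysis.
From mathcomp Require Import measurable_realfun.

Set Implicit Arguments.
Unset Strict Implicit.
Unset Printing Implicit Defensive.

Import Order.TTheory GRing.Theory Num.Theory.
Import ComplexField.Normc.

Local Open Scope classical_set_scope.
Local Open Scope ring_scope.
Local Open Scope complex_scope.
Local Open Scope quotient_scope.

(* An unbounded operator between lmodules is represented by its graph, a
   [set (E * F)]; equality of operators, domains included, is therefore equality
   of sets. Inner products are linear in the first argument. *)
Section operators.
Context {R : realType}.
Implicit Types E F G : lmodType R[i].

Definition op_dom E F (T : set (E * F)) : set E := [set x | exists y, T (x, y)].

Definition op_ker E F (T : set (E * F)) : set E := [set x | T (x, 0)].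

Definition is_operator E F (T : set (E * F)) : Prop :=
  [/\ T (0, 0),
      (forall (a : R[i]) p q, T p -> T q -> T (a *: p + q)) &
      (forall x y z, T (x, y) -> T (x, z) -> y = z)].

Definition op_comp E F G (S : set (F * G)) (T : set (E * F)) : set (E * G) :=
  [set p | exists2 y, T (p.1, y) & S (y, p.2)].

(* For [a = 0], this is the zero operator on the domain of [T]. *)
Definition op_scale E F (a : R[i]) (T : set (E * F)) : set (E * F) :=
  [set p | exists2 y, T (p.1, y) & p.2 = a *: y].

Definition op_add E F (S T : set (E * F)) : set (E * F) :=
  [set p | exists y z, [/\ S (p.1, y), T (p.1, z) & p.2 = y + z]].

Definition op_column E F (S T : set (E * F)) : set (E * (F * F)) :=
  [set p | S (p.1, p.2.1) /\ T (p.1, p.2.2)].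

Definition dot_pair F (dot : F -> F -> R[i]) (p q : F * F) : R[i] :=
  dot p.1 q.1 + dot p.2 q.2.

Definition dot_norm E (dot : E -> E -> R[i]) (x : E) : R :=
  Num.sqrt (complex.Re (dot x x)).

Definition densely_defined E F (dE : E -> E -> R[i]) (T : set (E * F)) : Prop :=
  forall (x : E) (e : R), 0 < e ->
    exists2 y, op_dom T y & dot_norm dE (x - y) < e.

Definition op_adjoint E F (dE : E -> E -> R[i]) (dF : F -> F -> R[i])
    (T : set (E * F)) : set (F * E) :=
  [set p | forall x y, T (x, y) -> dF y p.1 = dE x p.2].

Definition positive_selfadjoint E (dE : E -> E -> R[i]) (A : set (E * E)) :
    Prop :=
  [/\ is_operator A, densely_defined dE A, op_adjoint dE dE A = A &
      forall x y, A (x, y) -> 0 <= dE y x].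

(* [A] is the modulus of [T], i.e. the positive square root of [T^* T]. *)
Definition is_modulus E F (dE : E -> E -> R[i]) (dF : F -> F -> R[i])
    (T : set (E * F)) (A : set (E * E)) : Prop :=
  positive_selfadjoint dE A /\ op_comp A A = op_comp (op_adjoint dE dF T) T.

(* Bounded, everywhere defined, isometric on the orthogonal complement of its
   kernel. *)
Definition partial_isometry E F (dE : E -> E -> R[i]) (dF : F -> F -> R[i])
    (U : set (E * F)) : Prop :=
  [/\ is_operator U, op_dom U = setT,
      (exists M : R, forall x y, U (x, y) -> dot_norm dF y <= M * dot_norm dE x) &
      (forall x y, U (x, y) -> (forall z, op_ker U z -> dE x z = 0) ->
         dot_norm dF y = dot_norm dE x)].

Definition polar_decomposition E F (dE : E -> E -> R[i]) (dF : F -> F -> R[i])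
    (T : set (E * F)) (U : set (E * F)) (A : set (E * E)) : Prop :=
  [/\ is_modulus dE dF T A, partial_isometry dE dF U,
      op_ker U = op_ker T & T = op_comp U A].

Definition spherical_mean_component E (lam : R) (A U : set (E * E)) :
    set (E * E) :=
  op_add (op_scale lam%:C (op_comp U A))
         (op_scale (1 - lam)%:C (op_comp A U)).

(* The [lam]-spherical mean transform of [op_comp (op_column U1 U2) A]. *)
Definition spherical_mean E (lam : R) (A U1 U2 : set (E * E)) :
    set (E * (E * E)) :=
  op_column (spherical_mean_component lam A U1)
            (spherical_mean_component lam A U2).

End operators.

Section complex_L2.
Context d (X : measurableType d) (R : realType).

Definition cmeasurable (f : X -> R[i]) : Prop :=
  measurable_fun setT (fun x => complex.Re (f x)) /\
  measurable_fun setT (fun x => complex.Im (f x)).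

Lemma normc_sqr (z : R[i]) : normc z ^+ 2 = complex.Re z ^+ 2 + complex.Im z ^+ 2.
Proof. by case: z => a b /=; rewrite sqr_sqrtr// addr_ge0// sqr_ge0. Qed.

Definition sqr_mod (f : X -> R[i]) : X -> \bar R :=
  fun x => (normc (f x) ^+ 2)%:E.

Lemma sqr_mod_ge0 (f : X -> R[i]) (x : X) : (0 <= sqr_mod f x)%E.
Proof. by rewrite lee_fin sqr_ge0. Qed.

Lemma measurable_sqr_mod (f : X -> R[i]) : cmeasurable f ->
  measurable_fun setT (sqr_mod f).
Proof.
move=> [mr mi]; apply/measurable_EFinP.
under eq_fun do rewrite normc_sqr.
by apply: measurable_funD; exact: measurable_funX.
Qed.

Lemma cmeasurable_lin (a : R[i]) (f g : X -> R[i]) :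
  cmeasurable f -> cmeasurable g -> cmeasurable (a *: f + g).
Proof.
move=> [mf mf'] [mg mg']; split.
- rewrite (_ : (fun _ => _) = fun x => complex.Re a * complex.Re (f x) -
      complex.Im a * complex.Im (f x) + complex.Re (g x)).
    by apply: measurable_funD => //; apply: measurable_funB;
      apply: measurable_funM.
  apply/funext => x; rewrite !fctE.
  by case: a (f x) (g x) => [? ?] [? ?] [? ?].
- rewrite (_ : (fun _ => _) = fun x => complex.Re a * complex.Im (f x) +
      complex.Im a * complex.Re (f x) + complex.Im (g x)).
    by apply: measurable_funD => //; apply: measurable_funD;
      apply: measurable_funM.
  apply/funext => x; rewrite !fctE.
  by case: a (f x) (g x) => [? ?] [? ?] [? ?].
Qed.

Variable mu : {measure set X -> \bar R}.

Definition L2fun : {pred X -> R[i]} :=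
  [pred f | `[< cmeasurable f /\ (\int[mu]_x sqr_mod f x < +oo)%E >]].

Lemma L2funP (f : X -> R[i]) :
  reflect (cmeasurable f /\ (\int[mu]_x sqr_mod f x < +oo)%E) (f \in L2fun).
Proof. exact: asboolP. Qed.

Lemma L2fun_submod_closed : submod_closed L2fun.
Proof.
split.
  apply/L2funP; split; first by split; exact: measurable_cst.
  rewrite (eq_integral (cst 0%E)) ?integral0// => x _.
  by rewrite /sqr_mod normc0 expr0n.
move=> a f g /L2funP[mf ff] /L2funP[mg fg].
apply/L2funP; split; first exact: cmeasurable_lin.
pose k := 2 * normc a ^+ 2.
have k0 : 0 <= k by rewrite mulr_ge0// sqr_ge0.
have := measurable_sqr_mod mf; have := measurable_sqr_mod mg => msg msf.
have mkf : measurable_fun setT (fun x => k%:E * sqr_mod f x)%E.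
  exact: measurable_funeM.
have m2g : measurable_fun setT (fun x => 2%:E * sqr_mod g x)%E.
  exact: measurable_funeM.
apply: (@le_lt_trans _ _
    (\int[mu]_x (k%:E * sqr_mod f x + 2%:E * sqr_mod g x))%E).
  apply: ge0_le_integral => //.
  - by move=> x _; exact: sqr_mod_ge0.
  - by apply: measurable_sqr_mod; exact: cmeasurable_lin.
  - by apply: emeasurable_funD.
  - move=> x _; rewrite /sqr_mod -!EFinM -EFinD lee_fin !fctE.
    rewrite /k -mulrA -exprMn -normcM !normc_sqr.
    rewrite -[a *: f x]/(a * f x); case: (a * f x) (g x) => [p q] [r s] /=.
    rewrite -subr_ge0.
    rewrite (_ : _ - _ = (p - r) ^+ 2 + (q - s) ^+ 2); last by ring.
    by rewrite addr_ge0 ?sqr_ge0.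
rewrite ge0_integralD//; first last.
- by move=> x _; rewrite mule_ge0 ?sqr_mod_ge0.
- by move=> x _; rewrite mule_ge0 ?sqr_mod_ge0.
rewrite !ge0_integralZl//; try by move=> x _; exact: sqr_mod_ge0.
by rewrite lte_add_pinfty// lte_mul_pinfty.
Qed.

HB.instance Definition _ := GRing.isSubmodClosed.Build _ _ L2fun
  L2fun_submod_closed.

Record L2fun_type := L2Fun { L2fun_val :> X -> R[i]; _ : L2fun_val \in L2fun }.

HB.instance Definition _ := [isSub for L2fun_val].
HB.instance Definition _ := [Choice of L2fun_type by <:].
HB.instance Definition _ := [SubChoice_isSubLmodule of L2fun_type by <:].

Definition L2null : {pred L2fun_type} :=
  [pred f | `[< {ae mu, forall x, L2fun_val f x = 0} >]].

Lemma L2nullP (f : L2fun_type) :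
  reflect {ae mu, forall x, L2fun_val f x = 0} (f \in L2null).
Proof. exact: asboolP. Qed.

Lemma L2null_submod_closed : submod_closed L2null.
Proof.
split; first by apply/L2nullP; exact: aeW.
move=> a f g /L2nullP f0 /L2nullP g0; apply/L2nullP.
apply: filterS2 f0 g0 => x f0 g0.
rewrite -[L2fun_val _ _]/(a * L2fun_val f x + L2fun_val g x).
by rewrite f0 g0 mulr0 addr0.
Qed.

HB.instance Definition _ := GRing.isSubmodClosed.Build _ _ L2null
  L2null_submod_closed.

Definition L2 : Type := Quotient.quot L2null.
HB.instance Definition _ := GRing.Zmodule.on L2.
HB.instance Definition _ := EqQuotient.on L2.

Definition L2_repr (u : L2) : X -> R[i] := L2fun_val (repr u).
Coercion L2_repr : L2 >-> Funclass.

Definition L2_scale (a : R[i]) (u : L2) : L2 := \pi_L2 (a *: repr u).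

Lemma pi_L2_add (f g : L2fun_type) : \pi_L2 (f + g) = \pi_L2 f + \pi_L2 g.
Proof. exact: Quotient.pi_add. Qed.

Lemma pi_L2_scale a (f : L2fun_type) : \pi_L2 (a *: f) = L2_scale a (\pi_L2 f).
Proof.
apply/eqP; rewrite -Quotient.idealrBE -scalerBr rpredZ//.
by rewrite Quotient.idealrBE reprK.
Qed.

Let L2_scaleA a b u : L2_scale a (L2_scale b u) = L2_scale (a * b) u.
Proof. by rewrite {2}/L2_scale -pi_L2_scale scalerA. Qed.

Let L2_scale1 : left_id 1 L2_scale.
Proof. by move=> u; rewrite /L2_scale scale1r reprK. Qed.

Let L2_scaleDr : right_distributive L2_scale +%R.
Proof.
move=> a u v; rewrite -[u]reprK -[v]reprK -pi_L2_add -!pi_L2_scale.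
by rewrite scalerDr pi_L2_add.
Qed.

Let L2_scaleDl u : {morph L2_scale^~ u : a b / a + b}.
Proof. by move=> a b; rewrite /L2_scale scalerDl pi_L2_add. Qed.

HB.instance Definition _ := GRing.Zmodule_isLmodule.Build R[i] L2
  L2_scaleA L2_scale1 L2_scaleDr L2_scaleDl.

Definition cintegral (f : X -> R[i]) : R[i] :=
  (\int[mu]_x complex.Re (f x)) +i* (\int[mu]_x complex.Im (f x)).

Definition L2_dot (u v : L2) : R[i] := cintegral (fun x => u x * (v x)^*).

End complex_L2.

Section weighted_composition.
Context d (X : measurableType d) (R : realType).
Variable mu : {measure set X -> \bar R}.

Definition weighted_measure (w : X -> R[i]) (mw : cmeasurable w)
    : set X -> \bar R :=
  fun D => (\int[mu]_(x in D) sqr_mod w x)%E.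

Section measure_instance.
Variables (w : X -> R[i]) (mw : cmeasurable w).

Let weighted0 : weighted_measure mw set0 = 0%E.
Proof. exact: integral_set0. Qed.

Let weighted_ge0 D : (0 <= weighted_measure mw D)%E.
Proof. by apply: integral_ge0 => x _; exact: sqr_mod_ge0. Qed.

Let weighted_sigma_additive : semi_sigma_additive (weighted_measure mw).
Proof.
apply: semi_sigma_additive_nng_induced; first exact: measurable_sqr_mod.
exact: sqr_mod_ge0.
Qed.

HB.instance Definition _ := isMeasure.Build _ _ _ (weighted_measure mw)
  weighted0 weighted_ge0 weighted_sigma_additive.

End measure_instance.

(* The graph of f |-> w * (f \o phi) on its maximal domain. It does not depend
   on the chosen representatives as soon as the image under [phi] of
   [weighted_measure mu _] is absolutely continuous with respect to [mu]. *)
Definition weighted_comp (phi : X -> X) (w : X -> R[i]) :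
    set (L2 mu * L2 mu) :=
  [set p : L2 mu * L2 mu | {ae mu, forall x, p.2 x = w x * p.1 (phi x)}].

Section versions.
Variables (phi : X -> X) (w : X -> R[i]) (mw : cmeasurable w).

Definition is_RN_comp (h : X -> \bar R) : Prop :=
  [/\ measurable_fun setT h, (forall x, 0 <= h x)%E &
      forall D, measurable D ->
        weighted_measure mw (phi @^-1` D) = (\int[mu]_(x in D) h x)%E].

Definition is_cond_exp (f e : X -> \bar R) : Prop :=
  [/\ measurable_fun setT (e : g_sigma_algebra_preimageType phi -> \bar R),
      (forall x, 0 <= e x)%E &
      forall D, measurable D ->
        (\int[weighted_measure mw]_(x in phi @^-1` D) f x =
         \int[weighted_measure mw]_(x in phi @^-1` D) e x)%E].

(* [g] is the function denoted e \o phi^-1, for [h] as in [is_RN_comp]. *)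
Definition is_comp_inv (h e g : X -> \bar R) : Prop :=
  [/\ measurable_fun setT g,
      {ae mu, forall x, h x = 0%E -> g x = 0%E} &
      {ae weighted_measure mw, forall x, g (phi x) = e x}].

End versions.

(* On \bar R, 0 * +oo = 0 and x / +oo = 0; the latter convention only matters on
   a null set, since [h] is finite a.e. for a densely defined operator. *)
Definition Efun (H h g : X -> \bar R) : X -> \bar R :=
  fun x => if (0 < H x)%E then (g x * (h x / H x))%E else 0%E.

(* The junk values (0 / 0, +oo) can only occur on a null subset of [w != 0]. *)
Definition eta (phi : X -> X) (w : X -> R[i]) (H : X -> \bar R) : X -> R :=
  fun x => if w x == 0 then 0 else Num.sqrt (fine (H x / H (phi x))%E).

Definition mean_weight (lam : R) (phi : X -> X) (w : X -> R[i])
    (H : X -> \bar R) : X -> R[i] :=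
  fun x => (eta phi w H x + lam * (1 - eta phi w H x))%:C * w x.

End weighted_composition.

Arguments L2_dot {d X R} mu u v.
Arguments weighted_comp {d X R} mu phi w.
Arguments is_RN_comp {d X R} mu phi {w} mw h.
Arguments is_cond_exp {d X R} mu phi {w} mw f e.
Arguments is_comp_inv {d X R} mu phi {w} mw h e g.

(* Main.v *)
Require Import Defs.
From HB Require Import structures.
From mathcomp Require Import all_boot all_order all_algebra.
From mathcomp Require Import complex.
From mathcomp Require Import ring lra.
From mathcomp Require Import all_classical all_reals all_analysis.
From mathcomp Require Import measurable_realfun.

(**
Write H = h1 + h2 and let C be the column of the two weighted composition
operators.

The two transforms are explicit.  The image under phi_i of the measure
|w_i|^2 dmu has density h_i, so C f has squared norm the integral of |f|^2 H.
Accordingly |C| is multiplication by the square root of H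
([column_modulus]), and the components U_i of the isometric factor are the
weighted composition operators with weights w_i / sqrt (H o phi_i)
([polar_isometry_eq]).  Composing these formulas, U_i |C| is the restriction
of C_{phi_i, w_i} to the domain of |C| ([isometry_modulus_comp]), and
|C| U_i is C_{phi_i, eta_i w_i} with its maximal domain
([modulus_isometry_comp]).

For lam = 0 or 1 both sides of the equation between operators thus act by the
same formulas, and the only question is whether the domains agree.  A change
of variables gives the domain of |C| as the set of f in L^2 for which
|f|^2 H is integrable ([modulus_domP]), and the one of the column of the
operators |C| U_i as the set of f for which |f|^2 (E_1 + E_2) is integrable
([eta_comp_domP]); the conditional expectation enters there because
eta_i^2 = H / (H o phi_i) has a factor that is not a function of phi_i.  So
the equality says that integrability of one of the two functions implies
integrability of the other.  Over a sigma-finite measure, the implication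
holds for all f in L^2 only if one density is bounded by a multiple of 1 plus
the other ([domain_inclusion_iff]): otherwise the ratio is larger than 4^n on
some set of positive measure for every n, and a suitable series of indicators
of such sets violates the implication.

The operator |C| is only given as some positive selfadjoint A with
A A = C^* C, so that its identification is a uniqueness statement for
unbounded positive square roots.  It is proved without the spectral theorem
([positive_root_unique]).  Let b = 1 / (1 + H).  Multiplication by b is the
inverse of 1 + A A, hence commutes with A; then so do the polynomials in b
and, A being closed, their bounded pointwise limits, in particular
multiplication by r = sqrt (b (1 - b)) = sqrt H b.  For p = b u, the vector
y = b A p - r p satisfies A y = - sqrt H y.  As A is positive, sqrt H y = 0,
hence A y = 0 and, by symmetry, y = 0.  This is A p = sqrt H p, from which
A x = sqrt H x follows for all x in the domain of A; multiplication by sqrt H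
being symmetric, the two operators are equal.
*)

Import Order.TTheory GRing.Theory Num.Theory.
Import ComplexField.Normc numFieldNormedType.Exports.

Local Open Scope classical_set_scope.
Local Open Scope ring_scope.

Set Implicit Arguments.
Unset Strict Implicit.
Unset Printing Implicit Defensive.

Import HBNNSimple.


(** * Measurability of square roots and inverses *)

Section measurable_sqrt_inv.
Context d (T : measurableType d) (R : realType).
Implicit Types f : T -> R.

Lemma measurable_fun_sqrt f : measurable_fun setT f ->
  measurable_fun setT (fun x => Num.sqrt (f x)).
Proof.
move=> mf; apply: (measurableT_comp (f := @Num.sqrt R)) => //.
by apply: continuous_measurable_fun; exact: sqrt_continuous.
Qed.

(** Writing the inverse of y as y (y^2)^-1 reduces to powers of nonnegative
    numbers, whose measurability includes the point 0. *)
Lemma measurable_fun_invr f : measurable_fun setT f ->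
  measurable_fun setT (fun x => (f x)^-1).
Proof.
move=> mf; rewrite (_ : (fun x => _) = fun x => f x * (f x ^+ 2) `^ (-1)).
  apply: measurable_funM => //.
  apply: (measurableT_comp (f := @powR R ^~ (-1))).
    exact: measurable_powR.
  exact: measurable_funX.
apply/funext => x; rewrite powR_inv1 ?sqr_ge0// expr2 invfM.
by have [->|x0] := eqVneq (f x) 0; rewrite ?mul0r ?invr0// mulrA divff// mul1r.
Qed.

End measurable_sqrt_inv.

(** * Transfer of integrals between measure spaces *)

Section transfer.
Local Open Scope ereal_scope.
Context {R : realType}.

(** As k approaches l from below, k is identically 0 if l is 0; this excludes
    the indeterminate form 0 * +oo when b is infinite. *)
Lemma ge0_cvg_mulr (k : nat -> \bar R) (l b : \bar R) :
  (forall n, 0 <= k n) -> (forall n, k n <= l) -> 0 <= b ->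
  k n @[n --> \oo] --> l -> k n * b @[n --> \oo] --> l * b.
Proof.
move=> k0 kl b0 kl'.
case: b b0 => [b| |] b0 //; first exact: cvgeZr.
have [l0|l0] := eqVneq l 0.
  have -> : (fun n => k n * +oo) = cst (l * +oo).
    apply/funext => n; congr (_ * _); apply/eqP.
    by rewrite eq_le kl l0 k0.
  exact: cvg_cst.
have lgt0 : 0 < l by rewrite lt0e l0 (le_trans (k0 0%N)).
have /(_ _ kl') kpos : forall u : nat -> \bar R, u n @[n --> \oo] --> l ->
    \forall n \near \oo, 0 < u n.
  move=> u ul; have : \forall y \near l, 0 < y.
    by apply: open_nbhs_nbhs; split => //; exact: open_ereal_gt_ereal.
  by move=> /ul.
apply: cvg_near_cst; near=> n; rewrite !gt0_muley//; near: n; exact: kpos.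
Unshelve. all: by end_near. Qed.

Lemma integral_nnsfun_mulr d (Y : measurableType d)
    (m : {measure set Y -> \bar R}) d' (X : measurableType d') (phi : Y -> X)
    (F : Y -> \bar R) (k : {nnsfun X >-> R}) :
  measurable_fun setT phi -> measurable_fun setT F -> (forall y, 0 <= F y) ->
  \int[m]_y ((k (phi y))%:E * F y) =
  \sum_(r \in range k) r%:E * \int[m]_(y in phi @^-1` (k @^-1` [set r])) F y.
Proof.
move=> mphi mF F0.
have mk r : measurable (phi @^-1` (k @^-1` [set r])).
  by rewrite -[X in measurable X]setTI; apply: mphi.
transitivity (\int[m]_y \sum_(r \in range k)
    (r%:E * ((\1_(phi @^-1` (k @^-1` [set r])) y)%:E * F y))).
  apply: eq_integral => y _.
  under eq_fsbigr do rewrite muleA.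
  rewrite -ge0_mule_fsuml => [|r]; last first.
    by rewrite -EFinM; exact: nnfun_muleindic_ge0.
  congr (_ * _); rewrite fimfunE -fsumEFin//.
have i0 r y : 0 <= r%:E * ((\1_(phi @^-1` (k @^-1` [set r])) y)%:E * F y).
  by rewrite muleA mule_ge0// -EFinM nnfun_muleindic_ge0.
rewrite ge0_integral_fsum//; last first.
  move=> r; apply: emeasurable_funM => //; apply: emeasurable_funM => //.
  by apply/measurable_EFinP; exact: measurable_indic.
apply: eq_fsbigr => r rk.
have r0 : (0 <= r)%R by move: rk; rewrite inE => -[x _ <-].
rewrite ge0_integralZl//; last 2 first.
- apply: emeasurable_funM => //.
  by apply/measurable_EFinP; exact: measurable_indic.
- by move=> y _; rewrite mule_ge0// lee_fin indicE.
congr (_ * _); rewrite [RHS]integral_mkcond; apply: eq_integral => y _.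
by rewrite epatch_indic muleC.
Qed.

(** The hypothesis on the sets D says that the measures F1 dm1 and F2 dm2 have
    the same image in X, and both sides are the integral of k against this
    image.  Stated for two maps, it covers changes of variables, measures with
    a density and conditional expectations alike. *)
Lemma ge0_integral_transfer d1 d2 d' (Y1 : measurableType d1)
    (Y2 : measurableType d2) (X : measurableType d')
    (m1 : {measure set Y1 -> \bar R}) (m2 : {measure set Y2 -> \bar R})
    (phi1 : Y1 -> X) (phi2 : Y2 -> X) (F1 : Y1 -> \bar R) (F2 : Y2 -> \bar R) :
  measurable_fun setT phi1 -> measurable_fun setT phi2 ->
  measurable_fun setT F1 -> measurable_fun setT F2 ->
  (forall y, 0 <= F1 y) -> (forall y, 0 <= F2 y) ->
  (forall D, measurable D -> \int[m1]_(y in phi1 @^-1` D) F1 y =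
                             \int[m2]_(y in phi2 @^-1` D) F2 y) ->
  forall k : X -> \bar R, measurable_fun setT k -> (forall x, 0 <= k x) ->
  \int[m1]_y (k (phi1 y) * F1 y) = \int[m2]_y (k (phi2 y) * F2 y).
Proof.
move=> mphi1 mphi2 mF1 mF2 F10 F20 F12 k mk k0.
pose kn := nnsfun_approx measurableT mk.
have limE d (Y : measurableType d) (m : {measure set Y -> \bar R})
    (phi : Y -> X) (F : Y -> \bar R) : measurable_fun setT phi ->
    measurable_fun setT F -> (forall y, 0 <= F y) ->
    \int[m]_y (k (phi y) * F y) =
    limn (fun n => \int[m]_y ((kn n (phi y))%:E * F y)).
  move=> mphi mF F0.
  have kF y : k (phi y) * F y = limn (fun n => (kn n (phi y))%:E * F y).
    have knk : (kn n (phi y))%:E @[n --> \oo] --> k (phi y).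
      exact: cvg_nnsfun_approx.
    have nd : nondecreasing_seq (fun n => (kn n (phi y))%:E).
      by move=> a b ab; rewrite lee_fin; exact/lefP/nd_nnsfun_approx.
    apply/esym/cvg_lim => //; apply: ge0_cvg_mulr => //.
    - by move=> n; rewrite lee_fin.
    - move=> n; rewrite -(cvg_unique _ (ereal_nondecreasing_cvgn nd) knk)//.
      by apply: ereal_sup_ubound; exists n.
  under eq_integral do rewrite kF.
  apply: monotone_convergence => //.
  - move=> n; apply: emeasurable_funM => //; apply/measurable_EFinP.
    by apply: measurableT_comp mphi; exact: measurable_funP.
  - by move=> n y _; rewrite mule_ge0// lee_fin.
  - move=> y _ a b ab; rewrite lee_wpmul2r// lee_fin.
    exact/lefP/nd_nnsfun_approx.
rewrite !limE//; congr (limn _); apply/funext => n.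
rewrite !integral_nnsfun_mulr//; apply: eq_fsbigr => r _.
by rewrite F12.
Qed.

End transfer.

(** * Comparison of two integrability conditions *)

Section domain.
Local Open Scope ereal_scope.
Context d (X : measurableType d) (R : realType)
  (mu : {sigma_finite_measure set X -> \bar R}).

(** By sigma-finiteness: S is covered by countably many sets on which both the
    measure and the function a are bounded. *)
Lemma exists_finite_subset (S : set X) (a : X -> \bar R) :
  measurable S -> measurable_fun setT a ->
  (forall x, S x -> a x < +oo) -> mu S != 0 ->
  exists G (m : nat), [/\ measurable G, G `<=` S, 0 < mu G, mu G < +oo &
    forall x, G x -> a x <= m%:R%:E].
Proof.
move=> mS ma aoo S0; apply: contrapT => noG; case/negP: S0.
apply/eqP/negligibleP => //.
have [F FT mF] := sigma_finiteT mu.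
have mam (m : nat) : measurable [set x | a x <= m%:R%:E].
  by rewrite -[X in measurable X]setTI; exact: emeasurable_fun_infty_c.
apply: (@negligibleS _ _ _ _ (\bigcup_i \bigcup_m
    (S `&` F i `&` [set x | a x <= m%:R%:E]))).
  move=> x Sx; have : [set: X] x by [].
  rewrite FT => -[i _ Fix].
  exists i => //; exists (Num.bound (fine (a x))) => //; split => //=.
  have := aoo x Sx; case: (a x) => [r| |] //= _; last exact: leNye.
  by rewrite lee_fin; exact/ltW/unstable.ltr_bound.
apply: negligible_bigcup => i; apply: negligible_bigcup => m.
have [mFi Fioo] := mF i.
have mG : measurable (S `&` F i `&` [set x | a x <= m%:R%:E]).
  by apply: measurableI => //; exact: measurableI.
apply/negligibleP => //; apply: contrapT => G0; apply: noG.
exists (S `&` F i `&` [set x | a x <= m%:R%:E]), m; split => //.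
- by move=> x [[]].
- by rewrite lt0e measure_ge0 andbT; exact/eqP.
- apply: le_lt_trans Fioo; apply: le_measure; rewrite ?inE//.
  by move=> x [[]].
- by move=> x [].
Qed.

(** If no c works, the sets S n where b exceeds 4^n (1 + a) all have positive
    measure.  Choose a part G n of S n on which the integral of 1 + a is finite,
    and let K be the sum of the indicators of the G n, weighted so that the n-th
    one contributes 2^-(n+1) to the integral of K (1 + a).  Its contribution to
    the integral of K b is then at least 4^n 2^-(n+1), so that K b is not
    integrable. *)
Lemma domain_inclusion_bound (a b : X -> \bar R) :
  measurable_fun setT a -> measurable_fun setT b ->
  (forall x, 0 <= a x) -> (forall x, 0 <= b x) ->
  (forall k : X -> R, measurable_fun setT k -> (forall x, 0 <= k x)%R ->
     \int[mu]_x ((k x)%:E * (1 + a x)) < +oo ->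
     \int[mu]_x ((k x)%:E * b x) < +oo) ->
  exists2 c : R, (0 < c)%R & {ae mu, forall x, b x <= c%:E * (1 + a x)}.
Proof.
move=> ma mb a0 b0 ab; apply: contrapT => noc.
pose c (n : nat) : R := (4 ^ n)%:R.
have c0 n : (0 < c n)%R by rewrite /c ltr0n expn_gt0.
pose S n := [set x | (c n)%:E * (1 + a x) < b x].
have ma1 : measurable_fun setT (fun x => 1 + a x) by exact: emeasurable_funD.
have a1 x : 0 <= 1 + a x by rewrite adde_ge0.
have mca n : measurable_fun setT (fun x => (c n)%:E * (1 + a x)).
  exact: measurable_funeM.
have mS n : measurable (S n).
  by rewrite -[X in measurable X]setTI; exact: measurable_lte.
have S0 n : mu (S n) != 0.
  apply/negP => /eqP Sn0; apply: noc; exists (c n) => //.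
  by exists (S n); split => // x /= /negP; rewrite -ltNge.
have aoo n x : S n x -> a x < +oo.
  rewrite /S/= ltey; apply: contraTN => /eqP ->.
  by rewrite addey// gt0_muley ?lte_fin// -leNgt leey.
have /choice[G /choice[m GP]] : forall n, exists G (m : nat),
    [/\ measurable G, G `<=` S n, 0 < mu G, mu G < +oo &
    forall x, G x -> a x <= m%:R%:E].
  by move=> n; exact: (exists_finite_subset (mS n) ma (aoo n) (S0 n)).
have mG n : measurable (G n) by have [] := GP n.
pose t n := \int[mu]_(x in G n) (1 + a x).
have t_gt0 n : 0 < t n.
  have [_ _ G0 _ _] := GP n; apply: (lt_le_trans G0).
  rewrite /t -[leLHS]mul1e -integral_cst//; apply: ge0_le_integral => //.
    exact: measurable_funTS.
  by move=> x Gx; rewrite leeDl.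
have t_lty n : t n < +oo.
  have [_ _ _ Goo Gm] := GP n.
  apply: (@le_lt_trans _ _ (\int[mu]_(x in G n) (1 + (m n)%:R%:E))).
    apply: ge0_le_integral => //; first exact: measurable_funTS.
    by move=> x Gx; rewrite leeD2l// Gm.
  by rewrite integral_cst//= lte_mul_pinfty// adde_ge0// lee_fin.
have t_fin n : t n \is a fin_num by rewrite ge0_fin_numE// ltW.
have t0 n : (0 < fine (t n))%R by rewrite fine_gt0// t_gt0 t_lty.
pose q (n : nat) : R := (1 / (2 ^ n.+1)%:R / fine (t n))%R.
have q0 n : (0 <= q n)%R.
  by rewrite /q divr_ge0 ?divr_ge0// ltW.
pose f n x : \bar R := (q n * \1_(G n) x)%:E.
have f0 n x : 0 <= f n x by rewrite lee_fin mulr_ge0.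
have mf n : measurable_fun setT (f n).
  apply/measurable_EFinP; apply: measurable_funM => //.
pose K x := \sum_(n <oo) f n x.
have K0 x : 0 <= K x by apply: nneseries_ge0 => n _ _; exact: f0.
have mK : measurable_fun setT K by exact: ge0_emeasurable_sum.
have fint n (u : X -> \bar R) : measurable_fun setT u -> (forall x, 0 <= u x) ->
    \int[mu]_x (f n x * u x) = (q n)%:E * \int[mu]_(x in G n) u x.
  move=> mu' u0; rewrite [in RHS]integral_mkcond -ge0_integralZl//.
  - apply: eq_integral => x _; rewrite epatch_indic /f EFinM -muleA.
    by rewrite [_ * u x]muleC.
  - by apply/(measurable_restrictT _ (mG n)); exact: measurable_funTS.
  - by move=> x _; rewrite erestrict_ge0.
  - by rewrite lee_fin.
(* a is finite on every G n, so K vanishes where a is infinite *)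
have KS x : K x * (1 + a x) = \sum_(n <oo) (f n x * (1 + a x)).
  have [axoo|] := eqVneq (a x) +oo; last first.
    have := a0 x; rewrite /K; case: (a x) => [r| |]// r0 _.
    under [RHS]eq_eseriesr do rewrite muleC.
    by rewrite -EFinD nneseriesZl// muleC.
  have fx0 i : f i x = 0.
    rewrite /f indicE memNset ?mulr0// => Gx.
    by have [_ /(_ x Gx)/aoo] := GP i; rewrite axoo ltxx.
  rewrite /K eseries0 => [|i _ _]; last exact: fx0.
  by rewrite mul0e eseries0// => i _ _; rewrite fx0 mul0e.
have Kint : \int[mu]_x (K x * (1 + a x)) <= 1.
  under eq_integral do rewrite KS.
  rewrite integral_nneseries//; last 2 first.
  - by move=> n; exact: emeasurable_funM.
  - by move=> n x _; rewrite mule_ge0.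
  apply: le_trans (@epsilon_trick0 R 1%R xpredT ler01).
  rewrite le_eqVlt; apply/orP; left; apply/eqP.
  apply: eq_eseriesr => n _; rewrite fint// -/(t n) -(fineK (t_fin n)) -EFinM.
  by rewrite /q divfK// gt_eqF.
have Kfin : {ae mu, forall x, K x \is a fin_num}.
  have : mu.-integrable setT K.
    apply/integrableP; split => //.
    apply: (@le_lt_trans _ _ 1); last exact: ltry.
    apply: le_trans Kint; apply: ge0_le_integral => //.
    - exact: measurableT_comp.
    - by apply: emeasurable_funM.
    - move=> x _; rewrite gee0_abs//.
      by rewrite -[leLHS]mule1 lee_wpmul2l// leeDl.
  by move=> /(integrable_ae measurableT); apply: filterS => x; exact.
pose k x := fine (K x).
have mk : measurable_fun setT k by exact: measurableT_comp.
have kE (u : X -> \bar R) : measurable_fun setT u -> (forall x, 0 <= u x) ->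
    \int[mu]_x ((k x)%:E * u x) = \int[mu]_x (K x * u x).
  move=> mu' u0; apply: ge0_ae_eq_integral => //.
  - by apply: emeasurable_funM => //; exact/measurable_EFinP.
  - by apply: emeasurable_funM.
  - by move=> x _; rewrite mule_ge0// lee_fin fine_ge0.
  - by move=> x _; rewrite mule_ge0.
  - by apply: filterS Kfin => x Kx _; rewrite /k fineK.
have : \int[mu]_x (K x * b x) < +oo.
  rewrite -kE//; apply: ab => //; first by move=> x; rewrite fine_ge0.
  by rewrite kE// (le_lt_trans Kint)// ltry.
set I := \int[mu]_x _ => Ioo.
have I0 : 0 <= I by apply: integral_ge0 => x _; rewrite mule_ge0.
have In n : (2 ^ n)%:R%:E <= I * 2%:E.
  apply: (@le_trans _ _ ((q n * c n * fine (t n) * 2)%:E)).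
    rewrite lee_fin le_eqVlt; apply/orP; left; apply/eqP.
    have -> : c n = ((2 ^ n)%:R * (2 ^ n)%:R)%R by rewrite -natrM -expnMn.
    rewrite /q expnS natrM; field.
    by rewrite gt_eqF//= pnatr_eq0 expn_eq0.
  rewrite EFinM lee_wpmul2r//.
  apply: (@le_trans _ _ (\int[mu]_x (f n x * b x))).
    rewrite fint// -mulrA EFinM lee_wpmul2l ?lee_fin//.
    rewrite EFinM fineK// /t -ge0_integralZl//; last 2 first.
    - exact: measurable_funTS.
    - by rewrite lee_fin ltW.
    apply: ge0_le_integral => //.
    - by move=> x _; rewrite mule_ge0// lee_fin ltW.
    - exact: measurable_funTS.
    - exact: measurable_funTS.
    - by move=> x Gx; have [_ /(_ x Gx) Sx _ _ _] := GP n; exact: ltW.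
  apply: ge0_le_integral => //.
  - by move=> x _; rewrite mule_ge0.
  - exact: emeasurable_funM.
  - exact: emeasurable_funM.
  - move=> x _; rewrite lee_wpmul2r//.
    apply: le_trans (nneseries_lim_ge n.+1 _) => [|i _ _]; last exact: f0.
    by rewrite big_nat_recr//= leeDr// sume_ge0.
have Ifin : I \is a fin_num by rewrite ge0_fin_numE.
have [n] : exists n, (fine I * 2 < n%:R)%R.
  by exists (Num.bound (fine I * 2)); exact: unstable.ltr_bound.
apply/negP; rewrite -leNgt.
have := In n; rewrite -(fineK Ifin) -EFinM lee_fin; apply: le_trans.
by rewrite ler_nat ltnW// ltn_expl.
Qed.

End domain.

(** * Functions and vectors in L^2 *)

Local Open Scope complex_scope.
Local Open Scope quotient_scope.

Section L2_basics.
Context d (X : measurableType d) (R : realType)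
  (mu : {measure set X -> \bar R}).
Implicit Types (u v : L2 mu) (f : X -> R[i]).

Lemma L2_eqP u v : u = v <-> {ae mu, forall x, u x = v x}.
Proof.
split=> [-> //|uv]; first exact: aeW.
rewrite -[u]reprK -[v]reprK; apply/eqP; rewrite -Quotient.idealrBE.
apply/L2nullP; apply: filterS uv => x uv.
rewrite -[L2fun_val _ _]/(L2fun_val (repr u) x - L2fun_val (repr v) x).
by move: uv; rewrite /L2_repr => ->; rewrite subrr.
Qed.

Lemma L2_pi_ae (f : L2fun_type mu) :
  {ae mu, forall x, L2_repr (\pi_(L2 mu) f) x = L2fun_val f x}.
Proof.
have : repr (\pi_(L2 mu) f) - f \in L2null (mu := mu).
  by rewrite Quotient.idealrBE reprK.
move/L2nullP; apply: filterS => x.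
rewrite -[L2fun_val _ _]/(L2fun_val (repr (\pi_(L2 mu) f)) x - L2fun_val f x).
by move/eqP; rewrite subr_eq0 => /eqP.
Qed.

Definition L2_of f : L2 mu := \pi_(L2 mu) (insubd (0 : L2fun_type mu) f).

Lemma L2_ofE f : f \in L2fun mu -> {ae mu, forall x, L2_of f x = f x}.
Proof.
move=> fL; have := L2_pi_ae (insubd (0 : L2fun_type mu) f).
apply: filterS => x ->.
by rewrite -[L2fun_val _]/(val (insubd (0 : L2fun_type mu) f)) insubdK.
Qed.

Lemma L2_cmeasurable u : cmeasurable u.
Proof.
by rewrite /L2_repr; case: (repr u) => g gL /=; have /L2funP[] := gL.
Qed.

Lemma L2_lty u : (\int[mu]_x sqr_mod u x < +oo)%E.
Proof.
by rewrite /L2_repr; case: (repr u) => g gL /=; have /L2funP[] := gL.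
Qed.

Lemma L2_addE u v : {ae mu, forall x, L2_repr (u + v) x = u x + v x}.
Proof.
have -> : u + v = \pi_(L2 mu) (repr u + repr v) by rewrite pi_L2_add !reprK.
exact: L2_pi_ae.
Qed.

Lemma L2_scaleE (a : R[i]) u : {ae mu, forall x, L2_repr (a *: u) x = a * u x}.
Proof. exact: L2_pi_ae (a *: repr u). Qed.

Lemma L2_0E : {ae mu, forall x, L2_repr (0 : L2 mu) x = 0}.
Proof.
have -> : (0 : L2 mu) = 0 *: (0 : L2 mu) by rewrite scale0r.
by apply: filterS (L2_scaleE 0 (0 : L2 mu)) => x ->; rewrite mul0r.
Qed.

Lemma L2_subE u v : {ae mu, forall x, L2_repr (u - v) x = u x - v x}.
Proof.
rewrite -scaleN1r; apply: filterS2 (L2_addE u (-1 *: v)) (L2_scaleE (-1) v).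
by move=> x -> ->; rewrite mulN1r.
Qed.

End L2_basics.

Section L2_mul.
Context d (X : measurableType d) (R : realType)
  (mu : {measure set X -> \bar R}).
Implicit Types (u v : L2 mu) (F G : X -> R[i]) (f g : X -> R).

Lemma sqr_modE (z : R[i]) : normc z ^+ 2 = complex.Re (z * z^*).
Proof. by rewrite normc_sqr; case: z => a b /=; ring. Qed.

Lemma mul_conj_real (c : R) (z w : R[i]) :
  z * (c%:C * w)^* = c%:C * (z * w^*).
Proof.
case: z w => [a b] [p q].
by apply/eqP; rewrite eq_complex /=; apply/andP; split; apply/eqP; ring.
Qed.

Lemma Re_realM (c : R) (z : R[i]) : complex.Re (c%:C * z) = c * complex.Re z.
Proof. by case: z => a b /=; rewrite mul0r subr0. Qed.

Lemma Im_realM (c : R) (z : R[i]) : complex.Im (c%:C * z) = c * complex.Im z.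
Proof. by case: z => a b /=; rewrite mul0r addr0. Qed.

Lemma cmeasurable_mul F G : cmeasurable F -> cmeasurable G ->
  cmeasurable (fun x => F x * G x).
Proof.
move=> [rF iF] [rG iG]; split.
- rewrite (_ : (fun _ => _) = fun x => complex.Re (F x) * complex.Re (G x) -
      complex.Im (F x) * complex.Im (G x)).
    by apply: measurable_funB; exact: measurable_funM.
  by apply/funext => x; case: (F x) (G x) => [? ?] [? ?].
- rewrite (_ : (fun _ => _) = fun x => complex.Re (F x) * complex.Im (G x) +
      complex.Im (F x) * complex.Re (G x)).
    by apply: measurable_funD; exact: measurable_funM.
  by apply/funext => x; case: (F x) (G x) => [? ?] [? ?].
Qed.

Lemma cmeasurable_conj F : cmeasurable F -> cmeasurable (fun x => (F x)^*).
Proof.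
move=> [rF iF]; split.
- rewrite (_ : (fun _ => _) = fun x => complex.Re (F x))//.
  by apply/funext => x; case: (F x).
- rewrite (_ : (fun _ => _) = fun x => - complex.Im (F x)).
    exact: measurable_funN.
  by apply/funext => x; case: (F x).
Qed.

Lemma cmeasurable_real f : measurable_fun setT f ->
  cmeasurable (fun x => (f x)%:C).
Proof. by move=> mf; split => //=; exact: measurable_cst. Qed.

Lemma cmeasurable_comp F (phi : X -> X) : measurable_fun setT phi ->
  cmeasurable F -> cmeasurable (fun x => F (phi x)).
Proof.
move=> mphi [rF iF]; split.
- exact: (measurableT_comp rF mphi).
- exact: (measurableT_comp iF mphi).
Qed.

Lemma cintegral_ae F G : cmeasurable F -> cmeasurable G ->
  {ae mu, forall x, F x = G x} -> cintegral mu F = cintegral mu G.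
Proof.
move=> [rF iF] [rG iG] FG.
rewrite /cintegral /Rintegral; congr (fine _ +i* fine _).
- apply: ae_eq_integral => //; try exact/measurable_EFinP.
  by apply: filterS FG => x -> _.
- apply: ae_eq_integral => //; try exact/measurable_EFinP.
  by apply: filterS FG => x -> _.
Qed.

Lemma cmeasurable_dot u v : cmeasurable (fun x => u x * (v x)^*).
Proof.
by apply: cmeasurable_mul; [|apply: cmeasurable_conj]; exact: L2_cmeasurable.
Qed.

Lemma L2_dotE u v F : cmeasurable F ->
  {ae mu, forall x, u x * (v x)^* = F x} -> L2_dot mu u v = cintegral mu F.
Proof. by move=> mF uvF; apply: cintegral_ae => //; exact: cmeasurable_dot. Qed.

Lemma eq_L2_dot u v u' v' :
  {ae mu, forall x, u x * (v x)^* = u' x * (v' x)^*} ->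
  L2_dot mu u v = L2_dot mu u' v'.
Proof. by apply: L2_dotE; exact: cmeasurable_dot. Qed.

Lemma sqr_mod_mul F G x : sqr_mod (fun x => F x * G x) x =
  (sqr_mod F x * sqr_mod G x)%E.
Proof. by rewrite /sqr_mod normcM exprMn EFinM. Qed.

Lemma sqr_mod_real f x : sqr_mod (fun x => (f x)%:C) x = (f x ^+ 2)%:E.
Proof. by rewrite /sqr_mod normc_sqr /= expr0n addr0. Qed.

Definition L2norm2 u : R := fine (\int[mu]_x sqr_mod u x)%E.

Lemma L2norm2E u : (L2norm2 u)%:E = (\int[mu]_x sqr_mod u x)%E.
Proof.
rewrite fineK// ge0_fin_numE ?L2_lty//.
by apply: integral_ge0 => x _; exact: sqr_mod_ge0.
Qed.

Lemma L2norm2_ge0 u : 0 <= L2norm2 u.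
Proof.
by rewrite -lee_fin L2norm2E; apply: integral_ge0 => x _; exact: sqr_mod_ge0.
Qed.

Lemma L2_dotxx u : L2_dot mu u u = (L2norm2 u)%:C.
Proof.
rewrite /L2_dot /cintegral; congr (_ +i* _).
- rewrite /L2norm2 /Rintegral; congr fine; apply: eq_integral => x _.
  by rewrite /sqr_mod sqr_modE.
- rewrite /Rintegral (eq_integral (cst 0%E)) ?integral0// => x _.
  by congr EFin; case: (u x) => a b /=; ring.
Qed.

Lemma dot_normE u : dot_norm (L2_dot mu) u = Num.sqrt (L2norm2 u).
Proof. by rewrite /dot_norm L2_dotxx. Qed.

Lemma sqr_mod_eq0 (z : R[i]) : normc z ^+ 2 = 0 -> z = 0.
Proof. by move/eqP; rewrite expf_eq0/= => /eqP/eq0_normc. Qed.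

Lemma L2norm2_eq0 u : L2norm2 u = 0 -> u = 0.
Proof.
move=> u0; apply/L2_eqP.
have mu' := measurable_sqr_mod (L2_cmeasurable u).
have : (\int[mu]_x `|sqr_mod u x| = 0)%E.
  under eq_integral do rewrite gee0_abs ?sqr_mod_ge0//.
  by rewrite -L2norm2E u0.
move/(ae_eq_integral_abs mu measurableT mu').
apply: filterS2 (L2_0E mu) => x -> /(_ I) [].
exact: sqr_mod_eq0.
Qed.

(** Multiplication by f on its maximal domain, extended by 0: the value is only
    meaningful when f u is square integrable ([L2_mulE]). *)
Definition L2_mul f u : L2 mu := L2_of mu (fun x => (f x)%:C * u x).

Lemma L2fun_mul f u : measurable_fun setT f ->
  ((\int[mu]_x ((f x ^+ 2)%:E * sqr_mod u x) < +oo)%E) ->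
  (fun x => (f x)%:C * u x) \in L2fun mu.
Proof.
move=> mf foo; apply/L2funP; split.
  apply: cmeasurable_mul; first exact: cmeasurable_real.
  exact: L2_cmeasurable.
by under eq_integral do rewrite sqr_mod_mul sqr_mod_real.
Qed.

Lemma L2_mulE f u : measurable_fun setT f ->
  ((\int[mu]_x ((f x ^+ 2)%:E * sqr_mod u x) < +oo)%E) ->
  {ae mu, forall x, L2_mul f u x = (f x)%:C * u x}.
Proof. by move=> mf foo; apply: L2_ofE; exact: L2fun_mul. Qed.

Lemma L2_bmulE (M : R) f u : measurable_fun setT f -> (forall x, `|f x| <= M) ->
  {ae mu, forall x, L2_mul f u x = (f x)%:C * u x}.
Proof.
move=> mf fM; apply: L2_mulE => //.
have mu' := measurable_sqr_mod (L2_cmeasurable u).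
apply: (@le_lt_trans _ _ (\int[mu]_x ((M ^+ 2)%:E * sqr_mod u x))%E).
  apply: ge0_le_integral => //.
  - by move=> x _; rewrite mule_ge0 ?sqr_mod_ge0// lee_fin sqr_ge0.
  - apply: emeasurable_funM => //; apply/measurable_EFinP.
    exact: measurable_funX.
  - exact: measurable_funeM.
  - move=> x _; rewrite lee_wpmul2r ?sqr_mod_ge0// lee_fin.
    by rewrite -real_normK ?num_real// lerXn2r ?nnegrE// (le_trans _ (fM x)).
rewrite ge0_integralZl//; last 2 first.
- by move=> x _; exact: sqr_mod_ge0.
- by rewrite lee_fin sqr_ge0.
by rewrite lte_mul_pinfty// ?lee_fin ?sqr_ge0// L2_lty.
Qed.

Lemma normc_dot_le (z w : R[i]) :
  (`|complex.Re (z * w^*)| <= normc z ^+ 2 + normc w ^+ 2) /\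
  (`|complex.Im (z * w^*)| <= normc z ^+ 2 + normc w ^+ 2).
Proof.
have key (a b p q : R) :
    `|a * p + b * q| <= a ^+ 2 + b ^+ 2 + (p ^+ 2 + q ^+ 2).
  rewrite ler_norml; have := sqr_ge0 (a + p); have := sqr_ge0 (a - p).
  have := sqr_ge0 (b + q); have := sqr_ge0 (b - q).
  have := sqr_ge0 a; have := sqr_ge0 b; have := sqr_ge0 p; have := sqr_ge0 q.
  by move=> *; apply/andP; split; nra.
rewrite !normc_sqr; case: z w => [a b] [p q] /=; split.
- by have := key a b p q; rewrite mulrN opprK.
- by have := key b a p (- q); rewrite sqrrN addrC [b ^+ 2 + _]addrC addrC.
Qed.

End L2_mul.

Section dot_integrable.
Context d (X : measurableType d) (R : realType)
  (mu : {measure set X -> \bar R}).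
Implicit Types (u v : L2 mu).

Lemma integrable_sqr_mod u : mu.-integrable setT (sqr_mod u).
Proof.
apply/integrableP; split; first exact/measurable_sqr_mod/L2_cmeasurable.
by under eq_integral do rewrite gee0_abs ?sqr_mod_ge0//; exact: L2_lty.
Qed.

Lemma integrable_dot_Re u v :
  mu.-integrable setT (EFin \o (fun x => complex.Re (u x * (v x)^*))).
Proof.
apply: (le_integrable measurableT _ _
  (integrableD measurableT (integrable_sqr_mod u) (integrable_sqr_mod v))).
- by apply/measurable_EFinP; have [] := cmeasurable_dot u v.
- move=> x _ /=; rewrite lee_fin.
  have [h _] := normc_dot_le (u x) (v x).
  by rewrite (le_trans h)//; exact: ler_norm.
Qed.

Lemma integrable_dot_Im u v :
  mu.-integrable setT (EFin \o (fun x => complex.Im (u x * (v x)^*))).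
Proof.
apply: (le_integrable measurableT _ _
  (integrableD measurableT (integrable_sqr_mod u) (integrable_sqr_mod v))).
- by apply/measurable_EFinP; have [] := cmeasurable_dot u v.
- move=> x _ /=; rewrite lee_fin.
  have [_ h] := normc_dot_le (u x) (v x).
  by rewrite (le_trans h)//; exact: ler_norm.
Qed.

End dot_integrable.

Section dot_opp.
Context d (X : measurableType d) (R : realType)
  (mu : {measure set X -> \bar R}).

Lemma L2_dotNl (u v : L2 mu) : L2_dot mu (- u) v = - L2_dot mu u v.
Proof.
rewrite (@L2_dotE _ _ _ _ _ _ (fun x => - (u x * (v x)^*))); last 2 first.
- have [mr mi] := cmeasurable_dot u v; split.
  + rewrite (_ : (fun _ => _) = fun x => - complex.Re (u x * (v x)^*)).
      exact: measurable_funN.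
    by apply/funext => x; case: (u x * _).
  + rewrite (_ : (fun _ => _) = fun x => - complex.Im (u x * (v x)^*)).
      exact: measurable_funN.
    by apply/funext => x; case: (u x * _).
- rewrite -scaleN1r; apply: filterS (L2_scaleE (-1) u) => x ->.
  by rewrite mulN1r mulNr.
rewrite /L2_dot /cintegral.
transitivity ((-1 * \int[mu]_x complex.Re (u x * (v x)^*)) +i*
    (-1 * \int[mu]_x complex.Im (u x * (v x)^*))); last first.
  by rewrite !mulN1r.
rewrite -(RintegralZl _ measurableT (integrable_dot_Re u v)).
rewrite -(RintegralZl _ measurableT (integrable_dot_Im u v)).
congr (_ +i* _); apply: eq_Rintegral => x _.
- by case: (u x * _) => ? ? /=; rewrite mulN1r.
- by case: (u x * _) => ? ? /=; rewrite mulN1r.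
Qed.

Lemma L2_dot0l (v : L2 mu) : L2_dot mu 0 v = 0.
Proof.
rewrite (@L2_dotE _ _ _ _ _ _ (cst 0)); last 2 first.
- by split => //=; exact: measurable_cst.
- by apply: filterS (L2_0E mu) => x ->; rewrite mul0r.
by rewrite /cintegral /=; congr (_ +i* _);
  rewrite /Rintegral integral_cst ?mul0e.
Qed.

End dot_opp.

Section norm2.
Context d (X : measurableType d) (R : realType)
  (mu : {measure set X -> \bar R}).

Lemma L2norm2D (u v : L2 mu) :
  L2norm2 (u + v) <= 2 * L2norm2 u + 2 * L2norm2 v.
Proof.
have mN (u' : L2 mu) := measurable_sqr_mod (L2_cmeasurable u').
rewrite -lee_fin EFinD !EFinM !L2norm2E.
rewrite -!ge0_integralZl//; try by move=> x _; exact: sqr_mod_ge0.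
rewrite -ge0_integralD//; last 4 first.
- by move=> x _; rewrite mule_ge0 ?sqr_mod_ge0.
- exact: measurable_funeM.
- by move=> x _; rewrite mule_ge0 ?sqr_mod_ge0.
- exact: measurable_funeM.
apply: ae_ge0_le_integral => //.
- by move=> x _; exact: sqr_mod_ge0.
- by move=> x _; rewrite adde_ge0// mule_ge0 ?sqr_mod_ge0.
- by apply: emeasurable_funD; exact: measurable_funeM.
- apply: filterS (L2_addE u v) => x uvx _.
  rewrite /sqr_mod uvx -!EFinM -EFinD lee_fin !normc_sqr.
  case: (u x) (v x) => [a b] [p q] /=.
  have := sqr_ge0 (a - p); have := sqr_ge0 (b - q); nra.
Qed.

Lemma L2norm2N (u : L2 mu) : L2norm2 (- u) = L2norm2 u.
Proof.
apply: EFin_inj; rewrite !L2norm2E.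
apply: ae_eq_integral => //; try exact/measurable_sqr_mod/L2_cmeasurable.
rewrite -scaleN1r; apply: filterS (L2_scaleE (-1) u) => x ux _.
by rewrite /sqr_mod ux mulN1r; case: (u x) => a b; rewrite !normc_sqr /= !sqrrN.
Qed.

Lemma dot_norm_pairE (p : L2 mu * L2 mu) :
  dot_norm (dot_pair (L2_dot mu)) p = Num.sqrt (L2norm2 p.1 + L2norm2 p.2).
Proof. by rewrite /dot_norm /dot_pair !L2_dotxx. Qed.

End norm2.

(** * Multiplication operators commuting with a selfadjoint operator *)

Section bounded_limits.
Context d (X : measurableType d) (R : realType)
  (mu : {measure set X -> \bar R}).
Variables (s : nat -> X -> R) (r : X -> R).
Hypotheses (ms : forall n, measurable_fun setT (s n))
  (mr : measurable_fun setT r)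
  (s1 : forall n x, `|s n x| <= 1)
  (sr : forall x, s n x @[n --> \oo] --> r x).

(** Dominated convergence, with |F| as the dominating function. *)
Lemma Rintegral_bounded_cvg (F : X -> R) : mu.-integrable setT (EFin \o F) ->
  (\int[mu]_x (s n x * F x)) @[n --> \oo] --> \int[mu]_x (r x * F x).
Proof.
move=> iF.
have mF : measurable_fun setT F by apply/measurable_EFinP/(measurable_int mu).
have := @dominated_convergence _ X R mu setT measurableT
  (fun n x => (s n x * F x)%:E) (fun x => (r x * F x)%:E)
  (fun x => `|(F x)%:E|%E).
case.
- by move=> n; apply/measurable_EFinP; exact: measurable_funM.
- by apply/measurable_EFinP; exact: measurable_funM.
- apply: aeW => x _; apply: cvg_EFin; first exact: nearW.
  by apply: cvgMl; exact: sr.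
- exact: integrable_abse.
- apply: aeW => x n _ /=.
  by rewrite lee_fin normrM ler_piMl.
move=> irF _ cvgI.
apply: fine_cvg; rewrite fineK//.
exact: (integrable_fin_num measurableT irF).
Qed.

End bounded_limits.

Section commutant.
Context d (X : measurableType d) (R : realType)
  (mu : {measure set X -> \bar R}) (A : set (L2 mu * L2 mu)).
Hypothesis posA : positive_selfadjoint (L2_dot mu) A.
Implicit Types (u v x y : L2 mu) (f g : X -> R).

Let opA : is_operator A. Proof. by case: posA. Qed.
Let adjA : op_adjoint (L2_dot mu) (L2_dot mu) A = A. Proof. by case: posA. Qed.

Lemma selfadjoint_lin (a : R[i]) x y x' y' : A (x, y) -> A (x', y') ->
  A (a *: x + x', a *: y + y').
Proof. by case: opA => _ h _; exact: h. Qed.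

Lemma selfadjoint_sub x y x' y' : A (x, y) -> A (x', y') -> A (x - x', y - y').
Proof.
move=> h h'; have := selfadjoint_lin (-1) h' h.
by rewrite !scaleN1r ![- _ + _]addrC.
Qed.

Lemma selfadjoint_uniq x y y' : A (x, y) -> A (x, y') -> y = y'.
Proof. by case: opA => _ _; exact. Qed.

Lemma selfadjoint_sym x y x' y' : A (x, y) -> A (x', y') ->
  L2_dot mu y x' = L2_dot mu x y'.
Proof. by move=> h; rewrite -{1}adjA => h'; exact: h'. Qed.

(** The bounded functions f for which multiplication by f leaves the domain of A
    invariant and commutes with A there. *)
Definition commutes f :=
  [/\ measurable_fun setT f, exists M, forall t, `|f t| <= M &
    forall x y, A (x, y) -> A (L2_mul f x, L2_mul f y)].

Lemma commutes_mulE f x : commutes f ->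
  {ae mu, forall t, L2_mul f x t = (f t)%:C * x t}.
Proof. by move=> [mf [M fM] _]; exact: (L2_bmulE _ mf fM). Qed.

Lemma commutes_lin c f g : commutes f -> commutes g ->
  commutes (fun t => c * f t + g t).
Proof.
move=> cf cg; have [mf [M fM] Af] := cf; have [mg [N gN] Ag] := cg.
have mfg : measurable_fun setT (fun t => c * f t + g t).
  by apply: measurable_funD => //; exact: measurable_funM.
have fgMN t : `|c * f t + g t| <= `|c| * M + N.
  by rewrite (le_trans (ler_normD _ _))// lerD// normrM ler_wpM2l.
have fgE x : L2_mul (fun t => c * f t + g t) x =
    c%:C *: L2_mul f x + L2_mul g x.
  apply/L2_eqP.
  near=> t.
  rewrite (near (L2_bmulE x mfg fgMN) t)// (near (L2_addE _ _) t)//.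
  rewrite (near (L2_scaleE _ _) t)// (near (commutes_mulE x cf) t)//.
  rewrite (near (commutes_mulE x cg) t)//.
  by rewrite rmorphD rmorphM /= mulrDl mulrA.
split=> //; first by exists (`|c| * M + N).
by move=> x y xy; rewrite !fgE; apply: selfadjoint_lin; [exact: Af|exact: Ag].
Unshelve. all: by end_near. Qed.

Lemma commutes_mul f g : commutes f -> commutes g ->
  commutes (fun t => f t * g t).
Proof.
move=> cf cg; have [mf [M fM] Af] := cf; have [mg [N gN] Ag] := cg.
have mfg : measurable_fun setT (fun t => f t * g t) by exact: measurable_funM.
have fgMN t : `|f t * g t| <= M * N by rewrite normrM ler_pM.
have fgE x : L2_mul (fun t => f t * g t) x = L2_mul f (L2_mul g x).
  apply/L2_eqP; near=> t.
  rewrite (near (L2_bmulE x mfg fgMN) t)// (near (commutes_mulE _ cf) t)//.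
  rewrite (near (commutes_mulE x cg) t)//.
  by rewrite rmorphM /= mulrA.
split=> //; first by exists (M * N).
by move=> x y xy; rewrite !fgE; apply: Af; exact: Ag.
Unshelve. all: by end_near. Qed.

Lemma commutes_cst c : commutes (cst c).
Proof.
have E x : L2_mul (cst c) x = c%:C *: x.
  apply/L2_eqP; apply: filterS2 (L2_scaleE c%:C x)
    (@L2_bmulE _ _ _ mu `|c| (cst c) x (measurable_cst _) (fun _ => lexx _)).
  by move=> t -> ->.
split=> //; first by exists `|c|.
move=> x y xy; rewrite !E -[_ *: x]addr0 -[_ *: y]addr0.
apply: selfadjoint_lin => //.
by case: opA.
Qed.

(** As A is its own adjoint, membership of a pair in A is an equality of inner
    products with the pairs of A, and these pass to the limit. *)
Lemma commutes_lim (s : nat -> X -> R) (r : X -> R) :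
  (forall n, commutes (s n)) -> measurable_fun setT r ->
  (forall n t, `|s n t| <= 1) ->
  (forall t, s n t @[n --> \oo] --> r t) ->
  commutes r.
Proof.
move=> cs mr s1 sr.
have ms n : measurable_fun setT (s n) by case: (cs n).
have r1 t : `|r t| <= 1.
  by apply: (ler_cvg_to (cvg_norm (sr t)) (cvg_cst (1 : R))); exact: nearW.
split=> //; first by exists 1.
move=> x y xy; suff h (z w : L2 mu) : A (z, w) ->
    L2_dot mu w (L2_mul r x) = L2_dot mu z (L2_mul r y).
  by rewrite -adjA /= => z w; exact: h.
move=> zw.
have sE n : L2_dot mu w (L2_mul (s n) x) = L2_dot mu z (L2_mul (s n) y).
  by have [_ _ sxy] := cs n; exact: selfadjoint_sym zw (sxy _ _ xy).
have dE u v f (M : R) : measurable_fun setT f -> (forall t, `|f t| <= M) ->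
    L2_dot mu u (L2_mul f v) =
    cintegral mu (fun t => (f t)%:C * (u t * (v t)^*)).
  move=> mf fM; apply: L2_dotE.
    apply: cmeasurable_mul; last exact: cmeasurable_dot.
    exact: cmeasurable_real.
  apply: filterS (L2_bmulE v mf fM) => t ->.
  exact: mul_conj_real.
rewrite !(dE _ _ _ 1)//.
have {}sE n : cintegral mu (fun t => (s n t)%:C * (w t * (x t)^*)) =
   cintegral mu (fun t => (s n t)%:C * (z t * (y t)^*)).
  by rewrite -!(dE _ _ _ 1).
rewrite /cintegral; congr (_ +i* _).
- under eq_Rintegral do rewrite Re_realM.
  under [RHS]eq_Rintegral do rewrite Re_realM.
  have h1 := Rintegral_bounded_cvg ms mr s1 sr (integrable_dot_Re w x).
  have h2 := Rintegral_bounded_cvg ms mr s1 sr (integrable_dot_Re z y).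
  apply: cvg_unique h1 _ => //.
  apply: cvg_trans h2; apply: near_eq_cvg; apply: nearW => n.
  have := congr1 (@complex.Re R) (sE n); rewrite /cintegral /=.
  under eq_Rintegral do rewrite Re_realM.
  by under [in RHS]eq_Rintegral do rewrite Re_realM.
- under eq_Rintegral do rewrite Im_realM.
  under [RHS]eq_Rintegral do rewrite Im_realM.
  have h1 := Rintegral_bounded_cvg ms mr s1 sr (integrable_dot_Im w x).
  have h2 := Rintegral_bounded_cvg ms mr s1 sr (integrable_dot_Im z y).
  apply: cvg_unique h1 _ => //.
  apply: cvg_trans h2; apply: near_eq_cvg; apply: nearW => n.
  have := congr1 (@complex.Im R) (sE n); rewrite /cintegral /=.
  under eq_Rintegral do rewrite Im_realM.
  by under [in RHS]eq_Rintegral do rewrite Im_realM.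
Qed.

End commutant.

(** * Uniqueness of the positive square root *)

Section sqrt_iteration.
Context {R : realType}.
Implicit Types a : R.

(** Polynomials in a with limit sqrt a on [0, 1]; the square root is reached
    from multiplication by a through sums and products only. *)
Fixpoint sqrt_iter a n : R :=
  if n is m.+1 then sqrt_iter a m + 2^-1 * (a - sqrt_iter a m ^+ 2) else 0.

(** One step multiplies the error sqrt a - s by 1 - (sqrt a + s) / 2, which lies
    between 0 and 1 - sqrt a / 2. *)
Lemma sqrt_iter_bounds a n : 0 <= a <= 1 ->
  0 <= sqrt_iter a n <= Num.sqrt a /\
  Num.sqrt a - sqrt_iter a n <= Num.sqrt a * (1 - Num.sqrt a / 2) ^+ n.
Proof.
move=> /andP[a0 a1]; have : Num.sqrt a <= 1 by rewrite -sqrtr1 ler_wsqrtr.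
have := sqrtr_ge0 a; have := sqr_sqrtr a0; move: (Num.sqrt a) => q <- q0 q1.
elim: n => [|n [/andP[s0 sq] IH]] /=.
  by rewrite lexx q0 subr0 expr0 mulr1.
set t := sqrt_iter _ n in s0 sq IH *; set p := (1 - q / 2) ^+ n in IH.
have E : q - (t + 2^-1 * (q ^+ 2 - t ^+ 2)) = (q - t) * (1 - (q + t) / 2).
  by field.
have qt1 : 0 <= 1 - (q + t) / 2 by lra.
have qt0 : 0 <= q - t by rewrite subr_ge0.
split; first apply/andP; first split.
- by rewrite addr_ge0// mulr_ge0 ?invr_ge0// subr_ge0 lerXn2r.
- by rewrite -subr_ge0 E mulr_ge0.
- rewrite E exprSr mulrA ler_pM//; lra.
Qed.

Lemma sqrt_iter_cvg a : 0 <= a <= 1 ->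
  sqrt_iter a n @[n --> \oo] --> Num.sqrt a.
Proof.
move=> a01; have /andP[a0 a1] := a01.
have [sa0|sa0] := eqVneq (Num.sqrt a) 0.
  rewrite sa0 [X in X @ _](_ : _ = cst 0); first exact: cvg_cst.
  apply/funext => n; have [/andP[s0 s1] _] := sqrt_iter_bounds n a01.
  by apply/eqP; rewrite eq_le s0 -[X in _ <= X]sa0 s1.
have sgt0 : 0 < Num.sqrt a by rewrite lt0r sa0 sqrtr_ge0.
have sle1 : Num.sqrt a <= 1 by rewrite -sqrtr1 ler_wsqrtr.
apply: (@squeeze_cvgr _ _ _ _
  (fun n => Num.sqrt a - Num.sqrt a * (1 - Num.sqrt a / 2) ^+ n)
  (fun=> Num.sqrt a)).
- apply: nearW => n; have [/andP[s0 s1] s2] := sqrt_iter_bounds n a01.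
  by rewrite s1 andbT lerBlDr -lerBlDl.
- rewrite -[X in _ --> X]subr0; apply: cvgB; first exact: cvg_cst.
  rewrite -[X in _ --> X](mulr0 (Num.sqrt a)); apply: cvgMr.
  apply: cvg_expr; rewrite ger0_norm; lra.
- exact: cvg_cst.
Qed.

End sqrt_iteration.

Section positive_root.
Context d (X : measurableType d) (R : realType)
  (mu : {measure set X -> \bar R}) (A : set (L2 mu * L2 mu)).
Hypothesis posA : positive_selfadjoint (L2_dot mu) A.
Implicit Types (u v x y : L2 mu) (f g : X -> R).

Lemma commutes_sqrt f : (forall t, 0 <= f t <= 1) -> commutes A f ->
  commutes A (fun t => Num.sqrt (f t)).
Proof.
move=> f01 cf; have [mf _ _] := cf.
have cs n : commutes A (fun t => sqrt_iter (f t) n).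
  elim: n => [|n IH] /=; first exact: commutes_cst.
  have -> : (fun t =>
        sqrt_iter (f t) n + 2^-1 * (f t - sqrt_iter (f t) n ^+ 2)) =
      (fun t => 2^-1 * (f t + (- 1) * (sqrt_iter (f t) n * sqrt_iter (f t) n)) +
                sqrt_iter (f t) n).
    by apply/funext => t; rewrite addrC mulN1r expr2.
  apply: commutes_lin => //.
  rewrite (_ : (fun _ => _) = fun t => (- 1) *
      (sqrt_iter (f t) n * sqrt_iter (f t) n) + f t); last first.
    by apply/funext => t; rewrite addrC.
  by apply: commutes_lin => //; exact: commutes_mul.
apply: (commutes_lim posA cs).
- exact: measurable_fun_sqrt.
- move=> n t; have [/andP[s0 s1] _] := sqrt_iter_bounds n (f01 t).
  rewrite ger0_norm// (le_trans s1)// -sqrtr1 ler_wsqrtr//.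
  by case/andP: (f01 t).
- by move=> t; exact: sqrt_iter_cvg.
Qed.

Variable h : X -> R.
Hypotheses (mh : measurable_fun setT h) (h0 : forall t, 0 <= h t).

Let b t := (1 + h t)^-1.

Let h1 t : 0 < 1 + h t. Proof. by rewrite ltr_wpDr. Qed.

Let b01 t : 0 < b t <= 1.
Proof. by rewrite invr_gt0 h1/= invf_le1// lerDl. Qed.

Let mb : measurable_fun setT b.
Proof.
apply: measurable_fun_invr.
exact: measurable_funD.
Qed.

Hypothesis sqrA : forall u, exists2 q,
  A (L2_mul b u, q) & A (q, L2_mul (fun t => 1 - b t) u).

(** By [sqrA], (1 + A A) (b x) = x for all x.  For A x = y, the vector
    u = A (b x) - b y satisfies u + A (A u) = 0, so that the inner product of u
    with itself is the opposite of the one of A u, and u = 0. *)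
Lemma commutes_resolvent : commutes A b.
Proof.
have b1 t : `|b t| <= 1.
  by have /andP[b0 b1] := b01 t; rewrite ger0_norm// ltW.
have c1 t : `|1 - b t| <= 1.
  by have /andP[b0 b1'] := b01 t; rewrite ger0_norm; lra.
have mc : measurable_fun setT (fun t => 1 - b t) by exact: measurable_funB.
have bE x : L2_mul (fun t => 1 - b t) x = x - L2_mul b x.
  apply/L2_eqP; near=> t.
  rewrite (near (L2_bmulE x mc c1) t)// (near (L2_subE _ _) t)//.
  rewrite (near (L2_bmulE x mb b1) t)//.
  by rewrite rmorphB mulrBl mul1r.
split=> //; first by exists 1.
move=> x y xy.
have [q zq] := sqrA x; rewrite bE => qz.
have [q' zq'] := sqrA y; rewrite bE => qz'.
set z := L2_mul b x in zq qz *; set z' := L2_mul b y in zq' qz' *.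
suff -> : z' = q by [].
(* u is q - z', and v := A u satisfies A v = - u *)
have uv : A (q - z', (x - z) - q') := selfadjoint_sub posA qz zq'.
have vu : A ((x - z) - q', (y - q) - (y - z')) :=
  selfadjoint_sub posA (selfadjoint_sub posA xy zq) qz'.
have {}vu : A ((x - z) - q', z' - q).
  by move: vu; rewrite opprB [y - q + _]addrC addrA subrK.
have := selfadjoint_sym posA vu uv; rewrite L2_dotxx => vE.
have -> : z' = - (q - z') + q by rewrite opprB subrK.
suff -> : q - z' = 0 by rewrite oppr0 add0r.
apply: L2norm2_eq0; move: vE; rewrite -opprB L2_dotNl L2_dotxx.
move/(congr1 (@complex.Re R)) => /= vE; apply/eqP.
by rewrite eq_le L2norm2_ge0 andbT -oppr_ge0 vE L2norm2_ge0.
Unshelve. all: by end_near. Qed.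

Let r t := Num.sqrt (b t * (1 - b t)).

Let rE t : r t = Num.sqrt (h t) * b t.
Proof.
rewrite /r; have -> : b t * (1 - b t) = h t * b t ^+ 2.
  by rewrite /b; field; rewrite gt_eqF.
have /andP[b0 _] := b01 t.
by rewrite sqrtrM// sqrtr_sqr ger0_norm// ltW.
Qed.

Let bb01 t : 0 <= b t * (1 - b t) <= 1.
Proof. have /andP[b0 b1] := b01 t; apply/andP; split; nra. Qed.

Let cb : commutes A b. Proof. exact: commutes_resolvent. Qed.

Let cr : commutes A r.
Proof.
apply: commutes_sqrt bb01 _; apply: commutes_mul => //.
rewrite (_ : (fun _ => _) = fun t => -1 * b t + cst 1 t).
  by apply: commutes_lin => //; exact: commutes_cst.
by apply/funext => t; rewrite mulN1r addrC.
Qed.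

(** For p = b u and q = A p, the vector y = b q - r p is sent by A to
    - sqrt h y.  Positivity of A gives sqrt h y = 0, hence A y = 0; then, by
    symmetry, y is orthogonal to b q = A (b p), which differs from y by r p, a
    multiple of sqrt h.  Thus y = 0, that is q = r u. *)
Let root_on_range u : A (L2_mul b u, L2_mul r u).
Proof.
have [q pq qu] := sqrA u; set p := L2_mul b u in pq *.
set w := L2_mul _ u in qu.
have [_ _ Ab] := cb; have [_ _ Ar] := cr.
pose y : L2 mu := L2_mul b q - L2_mul r p.
pose y' : L2 mu := L2_mul b w - L2_mul r q.
have yy' : A (y, y') by apply: selfadjoint_sub => //; [exact: Ab|exact: Ar].
have c1 t : `|1 - b t| <= 1.
  by have /andP[b0 b1'] := b01 t; rewrite ger0_norm; lra.
have mc : measurable_fun setT (fun t => 1 - b t) by exact: measurable_funB.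
have yE : {ae mu, forall t, y t = (b t)%:C * q t - (r t * b t)%:C * u t}.
  near=> t; rewrite (near (L2_subE _ _) t)//.
  rewrite (near (commutes_mulE q cb) t)// (near (commutes_mulE p cr) t)//.
  by rewrite (near (commutes_mulE u cb) t)// rmorphM mulrA.
have y'E : {ae mu, forall t, y' t = - (Num.sqrt (h t))%:C * y t}.
  near=> t; rewrite (near (L2_subE _ _) t)//.
  rewrite (near (commutes_mulE w cb) t)// (near (commutes_mulE q cr) t)//.
  rewrite (near (L2_bmulE u mc c1) t)// (near yE t)//.
  have E1 : (r t)%:C = (Num.sqrt (h t))%:C * (b t)%:C by rewrite -rmorphM -rE.
  have E2 : (b t)%:C * (1 - b t)%:C =
      (Num.sqrt (h t))%:C * ((r t)%:C * (b t)%:C).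
    rewrite -!rmorphM /=; congr (_%:C); transitivity (r t * r t).
      by rewrite -expr2 sqr_sqrtr//; case/andP: (bb01 t).
    by rewrite {1}rE -mulrA [b t * _]mulrC.
  by rewrite mulrA E2 rmorphM /= E1; ring.
have hy0 : {ae mu, forall t, (Num.sqrt (h t))%:C * y t = 0}.
  have : 0 <= L2_dot mu y' y by case: posA => _ _ _; apply.
  pose G t := complex.Re (y' t * (y t)^*).
  have iG : mu.-integrable setT (EFin \o G) := integrable_dot_Re y' y.
  have GE : {ae mu, forall t, G t = - (Num.sqrt (h t) * normc (y t) ^+ 2)}.
    near=> t; rewrite /G (near y'E t)// normc_sqr.
    by case: (y t) => p1 p2 /=; ring.
  rewrite lecE /= => /andP[_]; rewrite /Rintegral -/G.
  have -> : (\int[mu]_t (G t)%:E = \int[mu]_t (- `|(G t)%:E|))%E.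
    apply: ae_eq_integral => //.
    - exact: measurable_int iG.
    - apply: measurableT_comp => //; apply: measurableT_comp => //.
      exact: measurable_int iG.
    - apply: filterS GE => t Gt _; rewrite abse_EFin -EFinN ler0_norm ?opprK//.
      by rewrite Gt oppr_le0 mulr_ge0 ?sqrtr_ge0 ?sqr_ge0.
  rewrite integral_ge0N//; have /integrableP[mG Goo] := iG.
  have I0 : (0 <= \int[mu]_t `|(G t)%:E|)%E by exact: integral_ge0.
  have Ifin : (\int[mu]_t `|(G t)%:E|)%E \is a fin_num by rewrite ge0_fin_numE.
  rewrite fineN oppr_ge0 => I1.
  have : (\int[mu]_t `|(EFin \o G) t| = 0)%E.
    apply/eqP; rewrite eq_le I0 andbT -(fineK Ifin) lee_fin; exact: I1.
  move/(ae_eq_integral_abs mu measurableT mG); apply: filterS2 GE.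
  move=> t Gt /(_ I) /= [] /eqP; rewrite Gt oppr_eq0 mulf_eq0.
  by move=> /orP[/eqP ->|/eqP/sqr_mod_eq0 ->]; rewrite ?mul0r ?mulr0.
have y'0 : y' = 0.
  apply/L2_eqP; near=> t.
  rewrite (near y'E t)// (near (L2_0E _) t)// mulNr.
  by rewrite (near hy0 t)// oppr0.
have : L2_dot mu y y = 0.
  have <- : L2_dot mu y (L2_mul b q) = 0.
    rewrite -(selfadjoint_sym posA yy' (Ab _ _ pq)) y'0.
    exact: L2_dot0l.
  apply: eq_L2_dot; near=> t.
  have : y t * (L2_mul r p t)^* = 0.
    rewrite (near (commutes_mulE p cr) t)// mul_conj_real rE rmorphM /=.
    rewrite (_ : _ * _ = (b t)%:C * ((Num.sqrt (h t))%:C * y t) * (p t)^*).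
      by rewrite (near hy0 t)// mulr0 mul0r.
    ring.
  have -> : L2_mul b q t = y t + L2_mul r p t.
    by rewrite (near (L2_subE (L2_mul b q) (L2_mul r p)) t)// subrK.
  by rewrite rmorphD mulrDr => ->; rewrite addr0.
rewrite L2_dotxx => /(congr1 (@complex.Re R))/= /L2norm2_eq0 y0.
suff -> : L2_mul r u = q by [].
apply/L2_eqP; near=> t.
rewrite (near (commutes_mulE u cr) t)//.
have : y t = 0 by rewrite y0 (near (L2_0E _) t).
rewrite (near yE t)// rmorphM /= => /eqP yt0; apply/eqP; move: yt0.
rewrite [_ * (b t)%:C]mulrC -mulrA -mulrBr mulf_eq0 subr_eq0 => /orP[|/eqP->//].
by rewrite fmorph_eq0 gt_eqF//; case/andP: (b01 t).
Unshelve. all: by end_near. Qed.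

(** Multiplying A x = y by b compares it with [root_on_range], so that A is
    contained in multiplication by sqrt h.  The latter being symmetric, it is
    contained in the adjoint of A, which is A. *)
Theorem positive_root_unique :
  A = weighted_comp mu id (fun t => (Num.sqrt (h t))%:C).
Proof.
have AB x y : A (x, y) -> {ae mu, forall t, y t = (Num.sqrt (h t))%:C * x t}.
  move=> xy; have [_ _ Ab] := cb.
  have E := selfadjoint_uniq posA (Ab _ _ xy) (root_on_range x).
  near=> t.
  have : L2_mul b y t = (b t)%:C * y t by near: t; exact: commutes_mulE y cb.
  rewrite E (near (commutes_mulE x cr) t)// rE rmorphM /= => /eqP rb.
  apply/eqP; move: rb.
  rewrite [_ * (b t)%:C]mulrC -mulrA -subr_eq0 -mulrBr mulf_eq0 subr_eq0.
  move=> /orP[|/eqP->//].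
  by rewrite fmorph_eq0 gt_eqF//; case/andP: (b01 t).
have adjA : op_adjoint (L2_dot mu) (L2_dot mu) A = A by case: posA.
apply/seteqP; split=> -[x y]; first exact: AB.
rewrite /= => xyE.
suff H (z w : L2 mu) : A (z, w) -> L2_dot mu w x = L2_dot mu z y.
  by rewrite -adjA /= => z w; exact: H.
move/AB => zw; apply: eq_L2_dot; near=> t.
by rewrite (near zw t)// (near xyE t)// mul_conj_real mulrA.
Unshelve. all: by end_near. Qed.

End positive_root.

(** * Weighted composition operators and their densities *)

Lemma weighted_comp_ae d (X : measurableType d) (R : realType)
    (mu : {measure set X -> \bar R}) (phi : X -> X) (w w' : X -> R[i]) :
  {ae mu, forall x, w x = w' x} ->
  weighted_comp mu phi w = weighted_comp mu phi w'.
Proof.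
move=> ww'; apply/seteqP; split => -[f g] /=.
- by apply: filterS2 ww' => x ->.
- by apply: filterS2 ww' => x ->.
Qed.

Section weighted.
Local Open Scope ereal_scope.
Context d (X : measurableType d) (R : realType)
  (mu : {measure set X -> \bar R}) (w : X -> R[i]) (mw : cmeasurable w).

Let mw2 : measurable_fun setT (sqr_mod w).
Proof. exact: measurable_sqr_mod. Qed.

Lemma ge0_integral_weighted (B : set X) (F : X -> \bar R) : measurable B ->
  measurable_fun setT F -> (forall x, 0 <= F x) ->
  \int[weighted_measure mu mw]_(x in B) F x =
  \int[mu]_(x in B) (F x * sqr_mod w x).
Proof.
move=> mB mF F0.
transitivity (\int[weighted_measure mu mw]_x ((F \_ B) x * 1)).
  by rewrite integral_mkcond; under [RHS]eq_integral do rewrite mule1.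
transitivity (\int[mu]_x ((F \_ B) x * sqr_mod w x)).
  apply: (ge0_integral_transfer (phi1 := id) (phi2 := id)) => //.
  - by move=> x; exact: sqr_mod_ge0.
  - move=> D mD; rewrite integral_cst//= mul1e; reflexivity.
  - by apply/(measurable_restrictT _ mB); exact: measurable_funTS.
  - by move=> x; exact: erestrict_ge0.
rewrite [RHS]integral_mkcond; apply: eq_integral => x _.
by rewrite !patchE; case: ifP => //; rewrite mul0e.
Qed.

Lemma ae_weighted (P : X -> Prop) :
  {ae weighted_measure mu mw, forall x, P x} ->
  {ae mu, forall x, (w x != 0)%R -> P x}.
Proof.
move=> [N [mN N0 PN]].
have : \int[mu]_(x in N) `|sqr_mod w x| = 0.
  by under eq_integral do rewrite gee0_abs ?sqr_mod_ge0//; exact: N0.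
move/(ae_eq_integral_abs mu mN (measurable_funTS mw2)).
apply: filterS => x xN w0; apply: contrapT => Px.
have /xN[] : N x by apply: PN.
by move/sqr_mod_eq0 => /eqP; rewrite (negbTE w0).
Qed.

Context (phi : {mfun X >-> X}) (h : X -> \bar R).
Hypothesis hP : is_RN_comp mu phi mw h.

Let mh : measurable_fun setT h. Proof. by case: hP. Qed.
Let h0 x : 0 <= h x. Proof. by case: hP => _ + _; exact. Qed.

Lemma ge0_integral_comp (k : X -> \bar R) : measurable_fun setT k ->
  (forall x, 0 <= k x) ->
  \int[mu]_x (k (phi x) * sqr_mod w x) = \int[mu]_x (k x * h x).
Proof.
apply: (ge0_integral_transfer (phi2 := id)) => //.
- by move=> x; exact: sqr_mod_ge0.
- by case: hP.
Qed.

(** The image of |w|^2 dmu under phi is h dmu, which charges neither the null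
    sets of mu nor the zeros of h. *)
Lemma ae_comp (P : X -> Prop) : {ae mu, forall x, h x != 0 -> P x} ->
  {ae mu, forall x, (w x != 0)%R -> h (phi x) != 0 /\ P (phi x)}.
Proof.
move=> [N [mN N0 PN]].
pose S := N `|` [set x | h x = 0].
have mS : measurable S.
  apply: measurableU => //; rewrite -[X in measurable X]setTI.
  exact: (measurable_eqe measurableT mh (measurable_cst 0)).
apply: (@ae_weighted (fun x => h (phi x) != 0 /\ P (phi x))).
exists (phi @^-1` S); split.
- by rewrite -[X in measurable X]setTI; exact: measurable_funP.
- case: hP => _ _ ->//.
  rewrite (eq_integral (fun x => `|h x|)) => [|x _]; last by rewrite gee0_abs.
  apply/(ae_eq_integral_abs mu mS (measurable_funTS mh)).
  by exists N; split => // x /= /not_implyP[[]].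
- move=> x /= nP; apply: contrapT => /not_orP[xN hx0]; apply: nP.
  have hn0 : h (phi x) != 0 by exact/eqP.
  split=> //; apply: contrapT => nP; apply: xN; apply: PN => /= /(_ hn0).
  exact: nP.
Qed.

Section conditional.
Variables (F e g : X -> \bar R).
Hypotheses (mF : measurable_fun setT F) (F0 : forall x, 0 <= F x).
Hypothesis eP : is_cond_exp mu phi mw F e.
Hypothesis gP : is_comp_inv mu phi mw h e g.

Let me : measurable_fun setT e.
Proof.
case: eP => me _ _ _ B mB; have := me measurableT B mB.
rewrite !setTI => -[C mC <-]; rewrite setTI -[X in measurable X]setTI.
exact: measurable_funP.
Qed.

Let e0 x : 0 <= e x. Proof. by case: eP => _ + _; exact. Qed.

(** As g o phi = e is nonnegative, the measure h dmu does not charge the set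
    where g is negative; so h = 0 almost everywhere on it, and g vanishes
    where h does. *)
Lemma comp_inv_ge0 : {ae mu, forall x, 0 <= g x}.
Proof.
case: gP => mg g0 ge.
have mN : measurable [set x | g x < 0].
  by rewrite -[X in measurable X]setTI; exact: emeasurable_fun_infty_o.
have : (\int[mu]_(x in [set x | g x < 0]) `|h x| = 0).
  rewrite (eq_integral h) => [|x _]; last by rewrite gee0_abs.
  case: hP => _ _ <-//; apply/negligibleP.
    by rewrite -[X in measurable X]setTI; exact: measurable_funP.
  case: ge => N [mN' N0 gN]; exists N; split => // x /= gx.
  by apply: gN => /= gex; move: gx; rewrite gex ltNge e0.
move/(ae_eq_integral_abs mu mN (measurable_funTS mh)); apply: filterS2 g0.
move=> x gx0 hx0; rewrite leNgt; apply/negP => gx.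
by have := gx0 (hx0 gx) => g0; move: gx; rewrite g0 ltxx.
Qed.

(** As k o phi is constant on the fibers of phi, F may be replaced by its
    conditional expectation e = g o phi, and the integrand becomes a function of
    phi.  The absolute value makes g nonnegative everywhere on the way. *)
Lemma ge0_integral_comp_inv (k : X -> \bar R) : measurable_fun setT k ->
  (forall x, 0 <= k x) ->
  \int[mu]_x (k (phi x) * (F x * sqr_mod w x)) =
  \int[mu]_x (k x * (g x * h x)).
Proof.
move=> mk k0; have [mg g0 ge] := gP.
have mkphi : measurable_fun setT (fun x => k (phi x)).
  exact: measurableT_comp.
have mgphi : measurable_fun setT (fun x => g (phi x)).
  exact: measurableT_comp.
transitivity (\int[mu]_x (k (phi x) * (e x * sqr_mod w x))).
  apply: (ge0_integral_transfer (phi1 := phi) (phi2 := phi)) => //.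
  - exact: emeasurable_funM.
  - exact: emeasurable_funM.
  - by move=> x; rewrite mule_ge0// sqr_mod_ge0.
  - by move=> x; rewrite mule_ge0// sqr_mod_ge0.
  - move=> D mD; case: eP => _ _ /(_ D mD).
    by rewrite !ge0_integral_weighted// -[X in measurable X]setTI;
      exact: measurable_funP.
transitivity (\int[mu]_x (k (phi x) * `|g (phi x)| * sqr_mod w x)).
  apply: ge0_ae_eq_integral => //.
  - by apply: emeasurable_funM => //; exact: emeasurable_funM.
  - apply: emeasurable_funM => //; apply: emeasurable_funM => //.
    exact: measurableT_comp.
  - by move=> x _; rewrite !mule_ge0// sqr_mod_ge0.
  - by move=> x _; rewrite !mule_ge0// sqr_mod_ge0.
  - apply: filterS (ae_weighted ge) => x gex _.
    have [w0|w0] := eqVneq (w x) 0%R.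
      by rewrite /sqr_mod w0 normc0 expr0n !mule0.
    by rewrite gex// gee0_abs// muleA.
rewrite (ge0_integral_comp (k := fun x => k x * `|g x|)); last 2 first.
- by apply: emeasurable_funM => //; exact: measurableT_comp.
- by move=> x; rewrite mule_ge0.
apply: ae_eq_integral => //.
- by apply: emeasurable_funM => //; apply: emeasurable_funM => //;
    exact: measurableT_comp.
- by apply: emeasurable_funM => //; exact: emeasurable_funM.
- by apply: filterS comp_inv_ge0 => x g0x _; rewrite gee0_abs// muleA.
Qed.

End conditional.

Lemma weighted_comp_domP (psi : X -> X) (v : X -> R[i]) (f : L2 mu) :
  measurable_fun setT psi -> cmeasurable v ->
  (exists z, weighted_comp mu psi v (f, z)) <->
  \int[mu]_x (sqr_mod f (psi x) * sqr_mod v x) < +oo.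
Proof.
move=> mpsi mv.
have mf := L2_cmeasurable f.
have mvf : cmeasurable (fun x => v x * f (psi x))%R.
  by apply: cmeasurable_mul => //; exact: cmeasurable_comp.
have E : \int[mu]_x (sqr_mod f (psi x) * sqr_mod v x) =
    \int[mu]_x sqr_mod (fun x => v x * f (psi x))%R x.
  by apply: eq_integral => x _; rewrite sqr_mod_mul muleC.
split.
- move=> [z /= zE]; apply: le_lt_trans (L2_lty z); rewrite E le_eqVlt.
  apply/orP; left; apply/eqP; apply: ae_eq_integral => //.
  + exact: measurable_sqr_mod.
  + exact/measurable_sqr_mod/L2_cmeasurable.
  + by apply: filterS zE => x zx _; rewrite /sqr_mod zx.
- rewrite E => foo; exists (L2_of mu (fun x => v x * f (psi x))%R) => /=.
  by apply: L2_ofE; apply/L2funP.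
Qed.

End weighted.

Section finite_density.
Local Open Scope ereal_scope.
Context d (X : measurableType d) (R : realType)
  (mu : {sigma_finite_measure set X -> \bar R}) (w : X -> R[i])
  (mw : cmeasurable w) (phi : {mfun X >-> X}) (h : X -> \bar R).
Hypothesis hP : is_RN_comp mu phi mw h.

(** The vectors in the domain vanish where h is infinite.  If that set had
    positive measure, the indicator of a part G of finite positive measure would
    be at distance at least sqrt (mu G) from the domain. *)
Lemma densely_defined_fin :
  densely_defined (L2_dot mu) (weighted_comp mu phi w) ->
  {ae mu, forall x, h x \is a fin_num}.
Proof.
have [mh h0 _] := hP => dd; apply: contrapT => nfin.
pose S := [set x | h x = +oo].
have mS : measurable S.
  rewrite -[X in measurable X]setTI.
  exact: (measurable_eqe measurableT mh (measurable_cst +oo)).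
have S0 : mu S != 0.
  apply/eqP => S0; apply: nfin; exists S; split => // x /= hx.
  apply: contrapT => hxoo; apply: hx; rewrite ge0_fin_numE// lt_neqAle leey.
  by rewrite andbT; exact/eqP.
have [G [m [mG GS G0 Goo _]]] := exists_finite_subset mS (measurable_cst 0)
  (fun x _ => ltry 0) S0.
pose f x := (\1_G x : R)%:C%C.
have mf : cmeasurable f by apply: cmeasurable_real; exact: measurable_indic.
have fL : f \in L2fun mu.
  apply/L2funP; split=> //; rewrite (eq_integral (fun x => (\1_G x)%:E)).
    by rewrite integral_indic// setIT.
  move=> x _; rewrite sqr_mod_real indicE; congr EFin.
  by case: (_ \in _); rewrite ?expr1n ?expr0n.
have muG : mu G \is a fin_num by rewrite ge0_fin_numE.
have e0 : (0 < Num.sqrt (fine (mu G)))%R by rewrite sqrtr_gt0 fine_gt0// G0.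
have [y [z [yz]]] : exists y z : L2 mu, weighted_comp mu phi w (y, z) /\
    (dot_norm (L2_dot mu) (L2_of mu f - y) < Num.sqrt (fine (mu G)))%R.
  by have [y [z yz] xy] := dd (L2_of mu f) _ e0; exists y, z.
rewrite dot_normE ltr_sqrt ?fine_gt0 ?G0// => xy.
have my := L2_cmeasurable y.
have yoo := (weighted_comp_domP y (measurable_funP phi) mw).1 (ex_intro _ z yz).
rewrite (ge0_integral_comp hP) in yoo; last 2 first.
- exact: measurable_sqr_mod.
- by move=> x; exact: sqr_mod_ge0.
have yfin : {ae mu, forall x, sqr_mod y x * h x \is a fin_num}.
  have : mu.-integrable setT (fun x => sqr_mod y x * h x).
    apply/integrableP; split.
      by apply: emeasurable_funM => //; exact: measurable_sqr_mod.
    by under eq_integral do rewrite gee0_abs ?mule_ge0 ?sqr_mod_ge0//.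
  by move/(integrable_ae measurableT); apply: filterS => x; exact.
suff : (fine (mu G) <= L2norm2 (L2_of mu f - y))%R by rewrite leNgt xy.
rewrite -lee_fin fineK// L2norm2E -[G]setIT -integral_indic//.
apply: ae_ge0_le_integral => //.
- by apply/measurable_EFinP; exact: measurable_indic.
- by move=> x _; exact: sqr_mod_ge0.
- exact/measurable_sqr_mod/L2_cmeasurable.
near=> x => _; rewrite indicE.
case: (boolP (x \in G)) => [|_]; last exact: sqr_mod_ge0.
rewrite inE => Gx; rewrite /sqr_mod (near (L2_subE _ _) x)//.
have -> : y x = 0%R.
  have : sqr_mod y x * h x \is a fin_num by near: x.
  rewrite (GS _ Gx); have [y0 _|y0] := eqVneq (normc (y x) ^+ 2)%R 0%R.
    exact: sqr_mod_eq0.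
  by rewrite /sqr_mod gt0_muley// lte_fin lt0r y0 sqr_ge0.
rewrite (near (L2_ofE fL) x)// subr0 lee_fin normc_sqr /f /= indicE mem_set//.
by rewrite expr1n expr0n addr0.
Unshelve. all: by end_near. Qed.

End finite_density.

Section dot_comp.
Context d (X : measurableType d) (R : realType)
  (mu : {measure set X -> \bar R}) (w : X -> R[i]) (mw : cmeasurable w)
  (phi : {mfun X >-> X}) (h : X -> \bar R).
Hypothesis hP : is_RN_comp mu phi mw h.
Hypothesis hfin : {ae mu, forall x, h x \is a fin_num}.

Let mh : measurable_fun setT h. Proof. by case: hP. Qed.
Let h0 x : (0 <= h x)%E. Proof. by case: hP => _ + _; exact. Qed.
Let mfh : measurable_fun setT (fun x => fine (h x)).
Proof. exact: measurableT_comp. Qed.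

Lemma measurable_normc2 : measurable_fun setT (fun x => normc (w x) ^+ 2).
Proof. by apply/measurable_EFinP; exact: measurable_sqr_mod. Qed.

(** [ge0_integral_comp] for the positive and the negative part of f. *)
Lemma Rintegral_comp (f : X -> R) : measurable_fun setT f ->
  \int[mu]_x (normc (w x) ^+ 2 * f (phi x)) = \int[mu]_x (fine (h x) * f x).
Proof.
move=> mf.
have mEf : measurable_fun setT (EFin \o f) by exact/measurable_EFinP.
have mu0 : measurable_fun setT (fun x => (fine (h x) * f x)%:E).
  by apply/measurable_EFinP; exact: measurable_funM.
have key (k : X -> \bar R) (F : X -> \bar R) (G : X -> \bar R):
    measurable_fun setT k -> (forall x, 0 <= k x)%E -> measurable_fun setT F ->
    (forall x, 0 <= F x)%E ->
    (forall x, G x = k (phi x) * sqr_mod w x)%E ->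
    (forall x, F x = k x * (fine (h x))%:E)%E ->
    (\int[mu]_x G x = \int[mu]_x F x)%E.
  move=> mk k0 mF F0 GE FE; under eq_integral do rewrite GE.
  rewrite (ge0_integral_comp hP)//; apply: ge0_ae_eq_integral => //.
  - exact: emeasurable_funM.
  - by move=> x _; rewrite mule_ge0.
  - by apply: filterS hfin => x hx _; rewrite FE fineK.
have maxM (c a : R) : 0 <= c ->
    (maxe (c * a)%:E 0 = maxe a%:E 0 * c%:E)%E.
  move=> c0; have [a0|a0] := lerP 0 a.
    by rewrite !max_l ?lee_fin ?mulr_ge0// -EFinM mulrC.
  rewrite !max_r ?mul0e ?lee_fin ?(ltW a0)//.
  by rewrite mulr_ge0_le0// ltW.
rewrite /Rintegral; congr fine; rewrite integralE [RHS]integralE.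
congr (_ - _)%E.
- apply: (key (EFin \o f)^\+%E) => //.
  + exact: measurable_funepos.
  + exact: measurable_funepos.
  + by move=> x; rewrite !funeposE /= maxM ?sqr_ge0.
  + by move=> x; rewrite !funeposE /= maxM ?fine_ge0.
- apply: (key (EFin \o f)^\-%E) => //.
  + exact: measurable_funeneg.
  + exact: measurable_funeneg.
  + by move=> x; rewrite !funenegE /= -mulrN maxM ?sqr_ge0.
  + by move=> x; rewrite !funenegE /= -mulrN maxM ?fine_ge0.
Qed.

Lemma L2_dot_comp (x t z y : L2 mu) :
  weighted_comp mu phi w (x, t) -> weighted_comp mu phi w (z, y) ->
  L2_dot mu t y = cintegral mu (fun s => (fine (h s))%:C * (x s * (z s)^*)).
Proof.
move=> /= tE yE; have [mr mi] := cmeasurable_dot x z.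
rewrite (@L2_dotE _ _ _ _ _ _
  (fun s => (normc (w s) ^+ 2)%:C * (x (phi s) * (z (phi s))^*))); last 2 first.
- apply: cmeasurable_mul.
    by apply: cmeasurable_real; exact: measurable_normc2.
  by apply: (@cmeasurable_comp _ _ _ (fun s => x s * (z s)^*)) => //;
    exact: cmeasurable_dot.
- apply: filterS2 tE yE => s -> ->; rewrite normc_sqr.
  case: (w s) (x (phi s)) (z (phi s)) => [a b] [p q] [p' q'].
  by apply/eqP; rewrite eq_complex /=; apply/andP; split; apply/eqP; ring.
rewrite /cintegral; congr (_ +i* _).
- under eq_Rintegral do rewrite Re_realM.
  under [RHS]eq_Rintegral do rewrite Re_realM.
  exact: (Rintegral_comp mr).
- under eq_Rintegral do rewrite Im_realM.
  under [RHS]eq_Rintegral do rewrite Im_realM.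
  exact: (Rintegral_comp mi).
Qed.

Lemma integrable_density (x t : L2 mu) : weighted_comp mu phi w (x, t) ->
  mu.-integrable setT (fun s => ((fine (h s)) * normc (x s) ^+ 2)%:E).
Proof.
move=> xt; have mx := measurable_sqr_mod (L2_cmeasurable x).
have m : measurable_fun setT (fun s => ((fine (h s)) * normc (x s) ^+ 2)%:E).
  apply/measurable_EFinP; apply: measurable_funM => //.
  exact/measurable_EFinP.
apply/integrableP; split=> //.
under eq_integral => s _.
  rewrite gee0_abs; last by rewrite lee_fin mulr_ge0 ?fine_ge0 ?sqr_ge0.
  over.
have := (weighted_comp_domP x (measurable_funP phi) mw).1 (ex_intro _ t xt).
rewrite (ge0_integral_comp hP)//; last by move=> s; exact: sqr_mod_ge0.
apply: le_lt_trans; rewrite le_eqVlt; apply/orP; left; apply/eqP.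
apply: ae_eq_integral => //; first exact: emeasurable_funM.
by apply: filterS hfin => s hs _; rewrite EFinM fineK// muleC.
Qed.

Lemma integrable_dot_density (x t z y : L2 mu) :
  weighted_comp mu phi w (x, t) -> weighted_comp mu phi w (z, y) ->
  mu.-integrable setT
    (EFin \o (fun s => fine (h s) * complex.Re (x s * (z s)^*))) /\
  mu.-integrable setT
    (EFin \o (fun s => fine (h s) * complex.Im (x s * (z s)^*))).
Proof.
move=> /integrable_density ix /integrable_density iz.
have [mr mi] := cmeasurable_dot x z.
split; apply: (le_integrable measurableT _ _ (integrableD measurableT ix iz)).
- by apply/measurable_EFinP; exact: measurable_funM.
- move=> s _ /=; rewrite lee_fin -mulrDr !normrM ler_wpM2l//.
  have [le _] := normc_dot_le (x s) (z s).
  by rewrite (le_trans le)//; exact: ler_norm.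
- by apply/measurable_EFinP; exact: measurable_funM.
- move=> s _ /=; rewrite lee_fin -mulrDr !normrM ler_wpM2l//.
  have [_ le] := normc_dot_le (x s) (z s).
  by rewrite (le_trans le)//; exact: ler_norm.
Qed.

End dot_comp.

(** * The modulus of the column *)

Section column.
Context d (X : measurableType d) (R : realType)
  (mu : {measure set X -> \bar R})
  (phi1 phi2 : {mfun X >-> X}) (w1 w2 : X -> R[i])
  (mw1 : cmeasurable w1) (mw2 : cmeasurable w2) (h1 h2 : X -> \bar R).
Hypotheses (h1P : is_RN_comp mu phi1 mw1 h1) (h2P : is_RN_comp mu phi2 mw2 h2).
Hypotheses (h1fin : {ae mu, forall x, h1 x \is a fin_num})
  (h2fin : {ae mu, forall x, h2 x \is a fin_num}).

Let H x := fine (h1 x) + fine (h2 x).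

Let mh1 : measurable_fun setT h1. Proof. by case: h1P. Qed.
Let mh2 : measurable_fun setT h2. Proof. by case: h2P. Qed.
Let h10 x : (0 <= h1 x)%E. Proof. by case: h1P => _ + _; exact. Qed.
Let h20 x : (0 <= h2 x)%E. Proof. by case: h2P => _ + _; exact. Qed.
Let H0 x : 0 <= H x. Proof. by rewrite addr_ge0// fine_ge0. Qed.
Let mfh1 : measurable_fun setT (fun x => fine (h1 x)).
Proof. exact: measurableT_comp. Qed.
Let mfh2 : measurable_fun setT (fun x => fine (h2 x)).
Proof. exact: measurableT_comp. Qed.
Let mH : measurable_fun setT H. Proof. exact: measurable_funD. Qed.

Let T := op_column (weighted_comp mu phi1 w1) (weighted_comp mu phi2 w2).

Lemma column_dot (x z : L2 mu) (t y : L2 mu * L2 mu) : T (x, t) -> T (z, y) ->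
  dot_pair (L2_dot mu) t y =
  cintegral mu (fun s => (H s)%:C * (x s * (z s)^*)).
Proof.
move=> [/= xt1 xt2] [/= zy1 zy2]; rewrite /dot_pair.
rewrite (L2_dot_comp h1P h1fin xt1 zy1) (L2_dot_comp h2P h2fin xt2 zy2).
have [ir1 ii1] := integrable_dot_density h1P h1fin xt1 zy1.
have [ir2 ii2] := integrable_dot_density h2P h2fin xt2 zy2.
rewrite /cintegral -[LHS]/(_ +i* _); congr (_ +i* _).
- under eq_Rintegral do rewrite Re_realM.
  under [X in _ + X]eq_Rintegral do rewrite Re_realM.
  under [RHS]eq_Rintegral do rewrite Re_realM mulrDl.
  by rewrite RintegralD.
- under eq_Rintegral do rewrite Im_realM.
  under [X in _ + X]eq_Rintegral do rewrite Im_realM.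
  under [RHS]eq_Rintegral do rewrite Im_realM mulrDl.
  by rewrite RintegralD.
Qed.

Lemma column_domP (f : L2 mu) :
  op_dom T f <-> (\int[mu]_x (sqr_mod f x * (H x)%:E) < +oo)%E.
Proof.
have mf := measurable_sqr_mod (L2_cmeasurable f).
have E : (\int[mu]_x (sqr_mod f x * (H x)%:E) =
    \int[mu]_x (sqr_mod f (phi1 x) * sqr_mod w1 x) +
    \int[mu]_x (sqr_mod f (phi2 x) * sqr_mod w2 x))%E.
  rewrite (ge0_integral_comp h1P)//; last by move=> x; exact: sqr_mod_ge0.
  rewrite (ge0_integral_comp h2P)//; last by move=> x; exact: sqr_mod_ge0.
  rewrite -ge0_integralD//.
  - apply: ae_eq_integral => //.
    + by apply: emeasurable_funM => //; exact/measurable_EFinP.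
    + by apply: emeasurable_funD; exact: emeasurable_funM.
    + apply: filterS2 h1fin h2fin => x f1 f2 _.
      by rewrite EFinD !fineK// ge0_muleDr.
  - by move=> x _; rewrite mule_ge0 ?sqr_mod_ge0.
  - exact: emeasurable_funM.
  - by move=> x _; rewrite mule_ge0 ?sqr_mod_ge0.
  - exact: emeasurable_funM.
rewrite E; split.
- move=> [[y1 y2]] [/= fy1 fy2]; apply: lte_add_pinfty.
  + by apply/(weighted_comp_domP f (measurable_funP phi1) mw1); exists y1.
  + by apply/(weighted_comp_domP f (measurable_funP phi2) mw2); exists y2.
- move=> oo; have ge0 (phi : X -> X) w :
      (0 <= \int[mu]_x (sqr_mod f (phi x) * sqr_mod w x))%E.
    by apply: integral_ge0 => x _; rewrite mule_ge0// sqr_mod_ge0.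
  have [y1 fy1] : exists y1, weighted_comp mu phi1 w1 (f, y1).
    apply/(weighted_comp_domP f (measurable_funP phi1) mw1).
    by apply: le_lt_trans oo; rewrite leeDl.
  have [y2 fy2] : exists y2, weighted_comp mu phi2 w2 (f, y2).
    apply/(weighted_comp_domP f (measurable_funP phi2) mw2).
    by apply: le_lt_trans oo; rewrite leeDr.
  by exists (y1, y2).
Qed.

Variable A : set (L2 mu * L2 mu).
Hypothesis modA : is_modulus (L2_dot mu) (dot_pair (L2_dot mu)) T A.

Let b t := (1 + H t)^-1.

Let H1 t : 0 < 1 + H t. Proof. by rewrite ltr_wpDr. Qed.

(** The hypothesis of [positive_root_unique] asks that A A send b u to
    (1 - b) u.  As b^2 H <= 1, the vector z = b u is in the domain of T, and
    [column_dot] says that T^* T z = H z, which is (1 - b) u. *)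
Theorem column_modulus :
  A = weighted_comp mu id (fun x => (Num.sqrt (H x))%:C).
Proof.
case: modA => posA AA; apply: positive_root_unique => // u.
rewrite -/b.
have b01 t : 0 < b t <= 1 by rewrite invr_gt0 H1/= invf_le1// lerDl.
have mb : measurable_fun setT b.
  apply: measurable_fun_invr.
  exact: measurable_funD.
have b1 t : `|b t| <= 1.
  by have /andP[b0 b1] := b01 t; rewrite ger0_norm// ltW.
have c1 t : `|1 - b t| <= 1.
  by have /andP[b0 b1'] := b01 t; rewrite ger0_norm; lra.
have mc : measurable_fun setT (fun t => 1 - b t) by exact: measurable_funB.
have bE := L2_bmulE u mb b1.
have cE := L2_bmulE u mc c1.
have HbE t : H t * b t = 1 - b t by rewrite /b; field; rewrite gt_eqF.
set z := L2_mul b u; set z' := L2_mul _ u.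
suff : op_comp (op_adjoint (L2_dot mu) (dot_pair (L2_dot mu)) T) T (z, z').
  by rewrite -AA => -[q zq qz]; exists q.
have [y zy] : op_dom T z.
  apply/column_domP; apply: le_lt_trans (L2_lty u).
  apply: ae_ge0_le_integral => //.
  - by move=> x _; rewrite mule_ge0 ?sqr_mod_ge0 ?lee_fin.
  - apply: emeasurable_funM; first exact/measurable_sqr_mod/L2_cmeasurable.
    exact/measurable_EFinP.
  - by move=> x _; exact: sqr_mod_ge0.
  - exact/measurable_sqr_mod/L2_cmeasurable.
  - apply: filterS bE => t + _; rewrite {1}/sqr_mod -/z => ->.
    rewrite normcM exprMn normc_sqr /= expr0n addr0 -EFinM lee_fin.
    rewrite (_ : _ * H t = (b t * (1 - b t)) * normc (u t) ^+ 2); last first.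
      by rewrite -HbE; ring.
    rewrite ler_piMl ?sqr_ge0//; have /andP[? ?] := b01 t; nra.
exists y => //= x t xt; rewrite (column_dot xt zy); apply/esym/L2_dotE.
  apply: cmeasurable_mul; first exact: cmeasurable_real.
  exact: cmeasurable_dot.
apply: filterS2 bE cE => s.
rewrite -/z -/z' => -> ->; rewrite !mul_conj_real [RHS]mulrA -rmorphM /=.
by rewrite -HbE.
Qed.

End column.

(** * The isometric factor *)

Section isometry_part.
Context d (X : measurableType d) (R : realType)
  (mu : {measure set X -> \bar R}) (w : X -> R[i]) (mw : cmeasurable w)
  (phi : {mfun X >-> X}) (h : X -> \bar R) (H : X -> R).
Hypothesis hP : is_RN_comp mu phi mw h.
Hypotheses (mH : measurable_fun setT H) (H0 : forall x, 0 <= H x).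
Hypothesis hH : {ae mu, forall x, (h x <= (H x)%:E)%E}.

Let mh : measurable_fun setT h. Proof. by case: hP. Qed.
Let h0 x : (0 <= h x)%E. Proof. by case: hP => _ + _; exact. Qed.

Lemma ae_comp_all (P : X -> Prop) : {ae mu, forall x, P x} ->
  {ae mu, forall x, w x != 0 -> P (phi x)}.
Proof.
move=> aeP; have : {ae mu, forall x, (h x != 0)%E -> P x}.
  by apply: filterS aeP.
by move/(ae_comp hP); apply: filterS => x + w0 => /(_ w0)[].
Qed.

(** The measure h dmu does not charge the zeros of H, as h <= H. *)
Lemma ae_comp_gt0 : {ae mu, forall x, w x != 0 -> 0 < H (phi x)}.
Proof.
have : {ae mu, forall x, (h x != 0)%E -> 0 < H x}.
  apply: filterS hH => x hx hn0; rewrite -lte_fin; apply: lt_le_trans hx.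
  by rewrite lt0e hn0 h0.
by move/(ae_comp hP); apply: filterS => x + w0 => /(_ w0)[].
Qed.

(** The weight of the components of the isometric factor. *)
Definition isometry_weight x : R[i] := ((Num.sqrt (H (phi x)))^-1)%:C * w x.

Lemma measurable_isometry_weight : cmeasurable isometry_weight.
Proof.
apply: cmeasurable_mul => //; apply: cmeasurable_real.
apply: measurable_fun_invr.
apply: measurable_fun_sqrt.
exact: measurableT_comp.
Qed.

(** After the change of variables, |f|^2 carries the factor h / H <= 1. *)
Lemma isometry_weight_contract (f : L2 mu) :
  (\int[mu]_x (sqr_mod f (phi x) * sqr_mod isometry_weight x) <=
   \int[mu]_x sqr_mod f x)%E.
Proof.
have mf := measurable_sqr_mod (L2_cmeasurable f).
have mHV : measurable_fun setT (fun x => ((H x)^-1)%:E).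
  apply/measurable_EFinP.
  by apply: measurable_fun_invr.
have HV0 x : (0 <= ((H x)^-1)%:E)%E by rewrite lee_fin invr_ge0.
rewrite (eq_integral (fun x => sqr_mod f (phi x) * ((H (phi x))^-1)%:E *
    sqr_mod w x)%E); last first.
  move=> x _; rewrite -muleA; congr (_ * _)%E.
  rewrite sqr_mod_mul; congr (_ * _)%E.
  by rewrite sqr_mod_real exprVn sqr_sqrtr.
rewrite (ge0_integral_comp hP (k := fun x => sqr_mod f x * ((H x)^-1)%:E)%E);
  last 2 first.
- exact: emeasurable_funM.
- by move=> x; rewrite mule_ge0 ?sqr_mod_ge0.
apply: ae_ge0_le_integral => //.
- by move=> x _; rewrite !mule_ge0 ?sqr_mod_ge0.
- by apply: emeasurable_funM => //; exact: emeasurable_funM.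
- by move=> x _; exact: sqr_mod_ge0.
apply: filterS hH => x hx _.
rewrite -muleA -[leRHS]mule1 lee_wpmul2l ?sqr_mod_ge0//.
apply: (@le_trans _ _ (((H x)^-1)%:E * (H x)%:E)%E); first exact: lee_wpmul2l.
rewrite -EFinM lee_fin; have [->|Hx] := eqVneq (H x) 0; first by rewrite mulr0.
by rewrite mulVf.
Qed.

Lemma isometry_part_total (f : L2 mu) :
  exists z, weighted_comp mu phi isometry_weight (f, z).
Proof.
apply/(weighted_comp_domP f (measurable_funP phi) measurable_isometry_weight).
by rewrite (le_lt_trans (isometry_weight_contract f))// L2_lty.
Qed.

Lemma isometry_part_norm (f z : L2 mu) :
  weighted_comp mu phi isometry_weight (f, z) -> L2norm2 z <= L2norm2 f.
Proof.
move=> fz; rewrite -lee_fin !L2norm2E.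
apply: le_trans (isometry_weight_contract f).
rewrite le_eqVlt; apply/orP; left; apply/eqP; apply: ae_eq_integral => //.
- exact/measurable_sqr_mod/L2_cmeasurable.
- apply: emeasurable_funM.
    apply: (measurableT_comp (f := sqr_mod f)) => //.
    exact/measurable_sqr_mod/L2_cmeasurable.
  exact/measurable_sqr_mod/measurable_isometry_weight.
- apply: filterS fz => x /= zx _.
  rewrite muleC -(sqr_mod_mul isometry_weight (fun x => f (phi x))).
  by rewrite /sqr_mod zx.
Qed.

Lemma isometry_part_sub (f z f' z' : L2 mu) :
  weighted_comp mu phi isometry_weight (f, z) ->
  weighted_comp mu phi isometry_weight (f', z') ->
  weighted_comp mu phi isometry_weight (f - f', z - z').
Proof.
move=> /= fz fz'; have sub := ae_comp_all (L2_subE f f').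
near=> x; rewrite (near (L2_subE z z') x)// (near fz x)// (near fz' x)//.
have [w0|w0] := eqVneq (w x) 0.
  by rewrite /isometry_weight w0 !(mulr0, mul0r) subr0.
by rewrite (near sub x)// mulrBr.
Unshelve. all: by end_near. Qed.

End isometry_part.

Section isometry.
Context d (X : measurableType d) (R : realType)
  (mu : {measure set X -> \bar R})
  (phi1 phi2 : {mfun X >-> X}) (w1 w2 : X -> R[i])
  (mw1 : cmeasurable w1) (mw2 : cmeasurable w2) (h1 h2 : X -> \bar R)
  (H : X -> R).
Hypotheses (h1P : is_RN_comp mu phi1 mw1 h1) (h2P : is_RN_comp mu phi2 mw2 h2).
Hypotheses (mH : measurable_fun setT H) (H0 : forall x, 0 <= H x).
Hypotheses (h1H : {ae mu, forall x, (h1 x <= (H x)%:E)%E})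
  (h2H : {ae mu, forall x, (h2 x <= (H x)%:E)%E}).
Variables (A U1 U2 : set (L2 mu * L2 mu)).
Hypothesis AE : A = weighted_comp mu id (fun x => (Num.sqrt (H x))%:C).

Let T := op_column (weighted_comp mu phi1 w1) (weighted_comp mu phi2 w2).
Let U := op_column U1 U2.
Hypothesis isoU : partial_isometry (L2_dot mu) (dot_pair (L2_dot mu)) U.
Hypothesis kerU : op_ker U = op_ker T.
Hypothesis TE : T = op_comp U A.

Let v1 := isometry_weight w1 phi1 H.
Let v2 := isometry_weight w2 phi2 H.

(** A vector supported where H = 0 is in the kernel of T, hence in that of U. *)
Let kernel_part (f : L2 mu) : {ae mu, forall x, 0 < H x -> f x = 0} ->
  U (f, (0, 0)).
Proof.
move=> f0; suff : op_ker U f by [].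
rewrite kerU; split => /=.
- near=> x; rewrite (near (L2_0E mu) x)//.
  have [->|w0] := eqVneq (w1 x) 0; first by rewrite mul0r.
  rewrite (near (ae_comp_all h1P f0) x)// ?mulr0//.
  exact: (near (ae_comp_gt0 h1P h1H) x).
- near=> x; rewrite (near (L2_0E mu) x)//.
  have [->|w0] := eqVneq (w2 x) 0; first by rewrite mul0r.
  rewrite (near (ae_comp_all h2P f0) x)// ?mulr0//.
  exact: (near (ae_comp_gt0 h2P h2H) x).
Unshelve. all: by end_near. Qed.

(** Here a = A k, so that U a = T k. *)
Let range_part (k a z1 z2 : L2 mu) :
  {ae mu, forall x, a x = (Num.sqrt (H x))%:C * k x} ->
  weighted_comp mu phi1 v1 (a, z1) -> weighted_comp mu phi2 v2 (a, z2) ->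
  U (a, (z1, z2)).
Proof.
move=> ak az1 az2.
have vk (phi : {mfun X >-> X}) (w : X -> R[i]) (mw : cmeasurable w) h
    (hP : is_RN_comp mu phi mw h)
    (hH : {ae mu, forall x, (h x <= (H x)%:E)%E}) (z : L2 mu) :
    weighted_comp mu phi (isometry_weight w phi H) (a, z) ->
    weighted_comp mu phi w (k, z).
  move=> /= az; near=> x; rewrite (near az x)// /isometry_weight.
  have [->|w0] := eqVneq (w x) 0; first by rewrite !(mulr0, mul0r).
  rewrite (near (ae_comp_all hP ak) x)//.
  have Hx : 0 < H (phi x) by apply: (near (ae_comp_gt0 hP hH) x).
  rewrite mulrACA -rmorphM mulVf ?mul1r//.
  by rewrite gt_eqF// sqrtr_gt0.
have kz : T (k, (z1, z2)).
  split; [exact: vk h1P h1H _ az1|exact: vk h2P h2H _ az2].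
move: kz; rewrite TE => -[a' /=]; rewrite AE /= => ka' Ua'.
suff -> : a = a' by [].
by apply/L2_eqP; apply: filterS2 ak ka' => x -> ->.
Unshelve. all: by end_near. Qed.

Let measurable_cond (P : pred R) : measurable [set y | P y] ->
  measurable_fun setT (fun x => (P (H x))%:R : R).
Proof.
move=> mP; rewrite (_ : (fun x => _) = \1_(H @^-1` [set y | P y])).
  by apply: measurable_indic; rewrite -[X in measurable X]setTI; exact: mH.
apply/funext => x; rewrite indicE; congr ((nat_of_bool _)%:R).
by apply/idP/idP; rewrite inE.
Qed.

(** Cut f into its restrictions to the sets where H = 0, where H >= 1 / (n + 1)
    and where 0 < H < 1 / (n + 1).  The polar decomposition determines U on the
    first, by [kernel_part], and on the second, which is A k for the vector
    k = f / sqrt H, by [range_part].  The third tends to 0 in norm as n grows,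
    and both U and the expected operator are bounded. *)
Lemma polar_isometry (f y1 y2 : L2 mu) : U (f, (y1, y2)) ->
  weighted_comp mu phi1 v1 (f, y1) /\ weighted_comp mu phi2 v2 (f, y2).
Proof.
move=> fy.
have [opU _ [M bU] _] := isoU.
have [z1 fz1] := isometry_part_total h1P mH H0 h1H f.
have [z2 fz2] := isometry_part_total h2P mH H0 h2H f.
(* r n, p and q are the indicators of the third, first and second set *)
pose c n : R := n.+1%:R^-1.
have c0 n : 0 < c n by rewrite invr_gt0.
pose r n x : R := ((0 < H x) && (H x < c n))%:R.
have mr n : measurable_fun setT (r n).
  apply: (measurable_cond (P := fun y => (0 < y) && (y < c n))).
  rewrite (_ : mkset _ = `]0, c n[%classic); first exact: measurable_itv.
  by apply/seteqP; split => y /=; rewrite in_itv.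
have r1 n x : `|r n x| <= 1.
  by rewrite /r; case: (_ && _); rewrite ?normr1 ?normr0.
have rE n := L2_bmulE f (mr n) (r1 n).
have bound n : L2norm2 (y1 - z1) + L2norm2 (y2 - z2) <=
    (2 * M ^+ 2 + 4) * L2norm2 (L2_mul (r n) f).
  pose p x : R := (H x == 0)%:R.
  have mp : measurable_fun setT p.
    apply: (measurable_cond (P := fun y => y == 0)).
    rewrite (_ : mkset _ = [set 0]); first exact: measurable_set1.
    by apply/seteqP; split => y /= /eqP.
  have p1 x : `|p x| <= 1.
    by rewrite /p; case: (_ == _); rewrite ?normr1 ?normr0.
  have pE := L2_bmulE f mp p1.
  pose q x : R := (c n <= H x)%R%:R.
  have mq : measurable_fun setT q.
    apply: (measurable_cond (P := fun y => c n <= y)).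
    rewrite (_ : mkset _ = `[c n, +oo[%classic); first exact: measurable_itv.
    by apply/seteqP; split => y /=; rewrite in_itv /= andbT.
  have q1 x : `|q x| <= 1.
    by rewrite /q; case: (c n <= H x); rewrite ?normr1 ?normr0.
  have qE := L2_bmulE f mq q1.
  pose t x : R := q x * (Num.sqrt (H x))^-1.
  have mt : measurable_fun setT t.
    apply: measurable_funM => //.
    apply: measurable_fun_invr.
    by apply: measurable_fun_sqrt.
  have t1 x : `|t x| <= (Num.sqrt (c n))^-1.
    rewrite /t /q; have [cH|_] := boolP (c n <= H x); last first.
      by rewrite mul0r normr0 invr_ge0 sqrtr_ge0.
    rewrite mul1r ger0_norm ?invr_ge0 ?sqrtr_ge0// lef_pV2 ?posrE ?sqrtr_gt0//.
      by rewrite ler_wsqrtr.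
    by rewrite (lt_le_trans (c0 n)).
  have tE := L2_bmulE f mt t1.
  set f0 := L2_mul p f in pE; set a := L2_mul q f in qE.
  set k := L2_mul t f in tE; set g := L2_mul (r n) f.
  have f00 : {ae mu, forall x, 0 < H x -> f0 x = 0}.
    by apply: filterS pE => x -> Hx; rewrite /p gt_eqF// mul0r.
  have ak : {ae mu, forall x, a x = (Num.sqrt (H x))%:C * k x}.
    apply: filterS2 qE tE => x -> ->; rewrite mulrA -rmorphM; congr (_%:C * _).
    rewrite /t mulrCA /q.
    have [cH|_] := boolP (c n <= H x); last by rewrite !mul0r.
    by rewrite divff ?mulr1// gt_eqF// sqrtr_gt0 (lt_le_trans (c0 n)).
  have gE : f - f0 - a = g.
    apply/L2_eqP; near=> x.
    rewrite (near (L2_subE (f - f0) a) x)// (near (L2_subE f f0) x)//.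
    rewrite (near pE x)// (near qE x)// (near (rE n) x)//.
    rewrite -{1}[f x]mul1r -[X in X * f x - _]/(1%:C) -!mulrBl -!rmorphB.
    congr (_%:C * _); rewrite /p /q /r.
    have := H0 x; rewrite le_eqVlt => /orP[/eqP <-|Hx].
      by rewrite eqxx ltxx leNgt c0 /= subrr subr0.
    by rewrite gt_eqF// Hx subr0 leNgt /=; case: (_ < _); rewrite ?subrr ?subr0.
  have [za1 az1] := isometry_part_total h1P mH H0 h1H a.
  have [za2 az2] := isometry_part_total h2P mH H0 h2H a.
  have Usub x y x' y' : U (x, y) -> U (x', y') -> U (x - x', y - y').
    case: opU => _ lin _ xy xy'.
    by have := lin (-1) _ _ xy' xy; rewrite /= !scaleN1r ![- _ + _]addrC.
  have Ug := Usub _ _ _ _ (Usub _ _ _ _ fy (kernel_part f00))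
    (range_part ak az1 az2).
  rewrite gE in Ug.
  have f0z (phi : {mfun X >-> X}) (w : X -> R[i]) (mw : cmeasurable w) h
      (hP : is_RN_comp mu phi mw h)
      (hH : {ae mu, forall x, (h x <= (H x)%:E)%E}) :
      weighted_comp mu phi (isometry_weight w phi H) (f0, 0).
    rewrite /weighted_comp /=; near=> x; rewrite (near (L2_0E mu) x)//.
    have [w0|w0] := eqVneq (w x) 0.
      by rewrite /isometry_weight w0 mulr0 mul0r.
    rewrite (near (ae_comp_all hP f00) x)// ?mulr0//.
    exact: (near (ae_comp_gt0 hP hH) x).
  have := isometry_part_sub h1P
    (isometry_part_sub h1P fz1 (f0z _ _ _ _ h1P h1H)) az1.
  rewrite gE => /(isometry_part_norm h1P mH H0 h1H) n1.
  have := isometry_part_sub h2P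
    (isometry_part_sub h2P fz2 (f0z _ _ _ _ h2P h2H)) az2.
  rewrite gE => /(isometry_part_norm h2P mH H0 h2H) n2.
  have n3 : L2norm2 (y1 - 0 - za1) + L2norm2 (y2 - 0 - za2) <=
      M ^+ 2 * L2norm2 g.
    have := bU _ _ Ug; rewrite dot_norm_pairE dot_normE /= => le.
    have s0 : 0 <= L2norm2 (y1 - 0 - za1) + L2norm2 (y2 - 0 - za2).
      by rewrite addr_ge0// L2norm2_ge0.
    rewrite -[leLHS]sqr_sqrtr// -[in leRHS](sqr_sqrtr (L2norm2_ge0 g)) -exprMn.
    by rewrite lerXn2r// nnegrE ?sqrtr_ge0// (le_trans _ le)// sqrtr_ge0.
  have E (y z za : L2 mu) : y - z = (y - 0 - za) + - (z - 0 - za).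
    by rewrite !subr0 opprB addrA subrK.
  rewrite (E y1 z1 za1) (E y2 z2 za2).
  have := L2norm2D (y1 - 0 - za1) (- (z1 - 0 - za1)).
  have := L2norm2D (y2 - 0 - za2) (- (z2 - 0 - za2)).
  rewrite !L2norm2N; lra.
have lim : L2norm2 (L2_mul (r n) f) @[n --> \oo] --> 0.
  have r0 x : r n x @[n --> \oo] --> (0 : R).
    apply: cvg_near_cst; have := H0 x; rewrite le_eqVlt => /orP[/eqP Hx|Hx].
      by apply: nearW => n; rewrite /r -Hx ltxx.
    near=> n; rewrite /r Hx /= ltNge; suff -> : c n <= H x by [].
    by apply: ltW; near: n; exact: near_infty_natSinv_lt (PosNum Hx).
  have LE n : L2norm2 (L2_mul (r n) f) = \int[mu]_x (r n x * normc (f x) ^+ 2).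
    have mf := measurable_sqr_mod (L2_cmeasurable f).
    rewrite /L2norm2 /Rintegral; congr fine; apply: ae_eq_integral => //.
    - exact/measurable_sqr_mod/L2_cmeasurable.
    - apply/measurable_EFinP; apply: measurable_funM => //.
      exact/measurable_EFinP.
    - apply: filterS (rE n) => x fx _; rewrite /sqr_mod fx normcM exprMn.
      have -> : normc (r n x)%:C ^+ 2 = r n x ^+ 2.
        by rewrite normc_sqr /= expr0n addr0.
      congr (_ * _)%:E.
      by rewrite /r; case: (_ && _); rewrite ?expr1n ?expr0n.
  have iF : mu.-integrable setT (EFin \o (fun x => normc (f x) ^+ 2)).
    exact: (integrable_sqr_mod f).
  have := Rintegral_bounded_cvg mr (r := cst 0) (measurable_cst _) r1 r0 iF.
  under eq_fun do rewrite -LE.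
  rewrite (_ : \int[mu]_x _ = 0)// /Rintegral.
  under eq_integral do rewrite mul0r.
  by rewrite integral0.
have s0 : L2norm2 (y1 - z1) + L2norm2 (y2 - z2) = 0.
  apply/eqP; rewrite eq_le addr_ge0 ?L2norm2_ge0// andbT.
  rewrite -[leRHS](mulr0 (2 * M ^+ 2 + 4)).
  apply: (ler_cvg_to (cvg_cst _) (cvgMr lim)).
  exact: nearW.
move/eqP: s0; rewrite paddr_eq0 ?L2norm2_ge0// => /andP[/eqP yz1 /eqP yz2].
move/L2norm2_eq0: yz1 => /eqP; rewrite subr_eq0 => /eqP ->.
by move/L2norm2_eq0: yz2 => /eqP; rewrite subr_eq0 => /eqP ->.
Unshelve. all: by end_near. Qed.

Lemma polar_isometry_eq :
  U1 = weighted_comp mu phi1 v1 /\ U2 = weighted_comp mu phi2 v2.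
Proof.
have [_ domU _ _] := isoU.
have tot (f : L2 mu) : exists y1 y2, U1 (f, y1) /\ U2 (f, y2).
  have : op_dom U f by rewrite domU.
  by move=> [[y1 y2] [/= f1 f2]]; exists y1, y2.
split; apply/seteqP; split => -[f y] /=.
- by have [y1 [y2 [_ f2]]] := tot f => fy; have [] := @polar_isometry f y y2.
- have [y1 [y2 [f1 f2]]] := tot f => fy.
  have [/= fy1 _] := @polar_isometry f y1 y2 (conj f1 f2).
  suff -> : y = y1 by [].
  by apply/L2_eqP; apply: filterS2 fy fy1 => x -> ->.
- by have [y1 [y2 [f1 _]]] := tot f => fy; have [] := @polar_isometry f y1 y.
- have [y1 [y2 [f1 f2]]] := tot f => fy.
  have [_ /= fy2] := @polar_isometry f y1 y2 (conj f1 f2).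
  suff -> : y = y2 by [].
  by apply/L2_eqP; apply: filterS2 fy fy2 => x -> ->.
Qed.

End isometry.

(** * The two products of the modulus and the isometric factor *)

Section components.
Context d (X : measurableType d) (R : realType)
  (mu : {measure set X -> \bar R}) (w : X -> R[i]) (mw : cmeasurable w)
  (phi : {mfun X >-> X}) (h : X -> \bar R) (H : X -> \bar R) (Hr : X -> R).
Hypothesis hP : is_RN_comp mu phi mw h.
Hypotheses (mH : measurable_fun setT H) (H0 : forall x, (0 <= H x)%E).
Hypotheses (mHr : measurable_fun setT Hr) (Hr0 : forall x, 0 <= Hr x).
Hypothesis HE : {ae mu, forall x, H x = (Hr x)%:E}.
Hypothesis hH : {ae mu, forall x, (h x <= (Hr x)%:E)%E}.

Let mh : measurable_fun setT h. Proof. by case: hP. Qed.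
Let h0 x : (0 <= h x)%E. Proof. by case: hP => _ + _; exact. Qed.

Let v := isometry_weight w phi Hr.
Let A := weighted_comp mu id (fun x => (Num.sqrt (Hr x))%:C).
Let U := weighted_comp mu phi v.
Let W := weighted_comp mu phi (fun x => (Defs.eta phi w H x)%:C * w x).

Let mv : cmeasurable v. Proof. exact: measurable_isometry_weight. Qed.

(** On the set where w is nonzero, H (phi x) is almost surely positive and H is
    almost surely finite at x and at phi x, so that the default values in the
    definition of eta do not occur. *)
Lemma eta_weightE :
  {ae mu, forall x, (Defs.eta phi w H x)%:C * w x = (Num.sqrt (Hr x))%:C * v x}.
Proof.
near=> x; rewrite /v /isometry_weight /Defs.eta.
have [->|w0] := eqVneq (w x) 0; first by rewrite !mulr0.
rewrite (near HE x)// (near (ae_comp_all hP HE) x)//.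
have Hx : 0 < Hr (phi x) by apply: (near (ae_comp_gt0 hP hH) x).
by rewrite inver gt_eqF// -EFinM /= sqrtrM// sqrtrV// rmorphM mulrA.
Unshelve. all: by end_near. Qed.

Let WE : W = weighted_comp mu phi (fun x => (Num.sqrt (Hr x))%:C * v x).
Proof. exact: weighted_comp_ae eta_weightE. Qed.

(** As U is everywhere defined, the domain of the product is limited only by the
    requirement that sqrt H U f be square integrable. *)
Lemma modulus_isometry_comp : op_comp A U = W.
Proof.
rewrite WE; apply/seteqP; split => -[f g] /=.
- by move=> [y fy yg]; apply: filterS2 fy yg => x /= -> ->; rewrite mulrA.
- move=> fg; have [y fy] := isometry_part_total hP mHr Hr0 hH f.
  exists y => //; apply: filterS2 fg fy => x /= -> ->.
  by rewrite mulrA.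
Qed.

(** The factors sqrt (H o phi) cancel, but the product keeps the domain of A. *)
Lemma isometry_modulus_comp (f g : L2 mu) :
  op_comp U A (f, g) <-> op_dom A f /\ weighted_comp mu phi w (f, g).
Proof.
have key (y : L2 mu) : A (f, y) ->
    {ae mu, forall x, v x * y (phi x) = w x * f (phi x)}.
  move=> /= fy; near=> x; rewrite /v /isometry_weight.
  have [->|w0] := eqVneq (w x) 0; first by rewrite !(mulr0, mul0r).
  rewrite (near (ae_comp_all hP fy) x)//.
  have Hx : 0 < Hr (phi x) by apply: (near (ae_comp_gt0 hP hH) x).
  by rewrite mulrACA -rmorphM mulVf ?mul1r// gt_eqF// sqrtr_gt0.
split.
- move=> [y fy yg]; split; first by exists y.
  by apply: filterS2 (key y fy) yg => x /= <-.
- move=> [[y fy] fg]; exists y => //=.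
  by apply: filterS2 (key y fy) fg => x /= ->.
Unshelve. all: by end_near. Qed.

Lemma modulus_domP (f : L2 mu) :
  op_dom A f <-> (\int[mu]_x (sqr_mod f x * H x) < +oo)%E.
Proof.
have mf := measurable_sqr_mod (L2_cmeasurable f).
have ms : cmeasurable (fun x => (Num.sqrt (Hr x))%:C).
  apply: cmeasurable_real.
  by apply: measurable_fun_sqrt.
have -> : (\int[mu]_x (sqr_mod f x * H x) =
    \int[mu]_x (sqr_mod f (idfun x) *
      sqr_mod (fun x => (Num.sqrt (Hr x))%:C) x))%E.
  apply: ae_eq_integral => //.
  - exact: emeasurable_funM.
  - by apply: emeasurable_funM => //; exact: measurable_sqr_mod.
  - apply: filterS HE => x Hx _.
    by rewrite Hx sqr_mod_real sqr_sqrtr.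
exact: (weighted_comp_domP f (@measurable_id _ _ setT) ms).
Qed.

Variables (e g : X -> \bar R).
Hypothesis eP : is_cond_exp mu phi mw H e.
Hypothesis gP : is_comp_inv mu phi mw h e g.

(** A version of [Efun H h g] which is nonnegative and measurable everywhere. *)
Definition Efun_version x : \bar R := (`|g x| * (h x * ((Hr x)^-1)%:E))%E.

Let mHV : measurable_fun setT (fun x => ((Hr x)^-1)%:E).
Proof.
apply/measurable_EFinP.
by apply: measurable_fun_invr.
Qed.

Let HV0 x : (0 <= ((Hr x)^-1)%:E)%E. Proof. by rewrite lee_fin invr_ge0. Qed.

Lemma Efun_version_ge0 x : (0 <= Efun_version x)%E.
Proof. by rewrite !mule_ge0. Qed.

Lemma measurable_Efun_version : measurable_fun setT Efun_version.
Proof.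
have [mg _ _] := gP; apply: emeasurable_funM; last exact: emeasurable_funM.
exact: measurableT_comp.
Qed.

Lemma EfunE : {ae mu, forall x, Efun H h g x = Efun_version x}.
Proof.
apply: filterS3 HE hH (comp_inv_ge0 hP eP gP) => x Hx hx g0.
rewrite /Efun /Efun_version Hx lte_fin gee0_abs//.
have := Hr0 x; rewrite le_eqVlt => /orP[/eqP H00|Hgt0].
  rewrite -H00 ltxx; have -> : h x = 0%E.
    by apply/eqP; rewrite eq_le h0 andbT; move: hx; rewrite -H00.
  by rewrite mul0e mule0.
by rewrite Hgt0 inver gt_eqF.
Qed.

(** The squared norm of the image of f is the integral of the product of
    (|f|^2 / H) o phi by H |w|^2; the factor H is not a function of phi, and
    passing to its conditional expectation yields the integral of
    |f|^2 g h / H. *)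
Lemma eta_comp_domP (f : L2 mu) :
  op_dom W f <-> (\int[mu]_x (sqr_mod f x * Efun_version x) < +oo)%E.
Proof.
have mf := measurable_sqr_mod (L2_cmeasurable f).
have [mg _ _] := gP.
have ms : cmeasurable (fun x => (Num.sqrt (Hr x))%:C * v x).
  apply: cmeasurable_mul => //; apply: cmeasurable_real.
  by apply: measurable_fun_sqrt.
suff -> : (\int[mu]_x (sqr_mod f x * Efun_version x) = \int[mu]_x
    (sqr_mod f (phi x) *
     sqr_mod ((fun x => (Num.sqrt (Hr x))%:C * v x)%R : X -> R[i]) x))%E.
  by rewrite WE; exact: (weighted_comp_domP f (measurable_funP phi) ms).
pose k x := (sqr_mod f x * ((Hr x)^-1)%:E)%E.
have mk : measurable_fun setT k by exact: emeasurable_funM.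
have k0 x : (0 <= k x)%E by rewrite mule_ge0 ?sqr_mod_ge0.
have mkphi : measurable_fun setT (fun x => k (phi x)).
  exact: measurableT_comp.
transitivity (\int[mu]_x (k x * (g x * h x)))%E.
  apply: ae_eq_integral => //.
  - by apply: emeasurable_funM => //; exact: measurable_Efun_version.
  - by apply: emeasurable_funM => //; exact: emeasurable_funM.
  - apply: filterS (comp_inv_ge0 hP eP gP) => x g0 _.
    rewrite /Efun_version gee0_abs// /k -!muleA; congr (_ * _)%E.
    by rewrite [RHS]muleC -muleA.
rewrite -(ge0_integral_comp_inv hP mH H0 eP gP mk k0).
apply: ae_eq_integral => //.
- apply: emeasurable_funM => //; apply: emeasurable_funM => //.
  exact: measurable_sqr_mod.
- apply: emeasurable_funM; last exact: measurable_sqr_mod.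
  exact: measurableT_comp.
- apply: filterS HE => x Hx _; rewrite !sqr_mod_mul !sqr_mod_real Hx.
  rewrite exprVn !sqr_sqrtr// /k -!muleA; congr (_ * _)%E.
  by rewrite !muleA [X in (X * _)%E]muleC.
Qed.

End components.

Section spherical_component.
Context d (X : measurableType d) (R : realType)
  (mu : {measure set X -> \bar R}) (A U : set (L2 mu * L2 mu)).

(** The zero multiple of U A does not change the values, but it restricts the
    domain to the one of A. *)
Lemma spherical_component0 f g : op_dom U = setT ->
  spherical_mean_component 0 A U (f, g) <-> op_dom A f /\ op_comp A U (f, g).
Proof.
move=> domU; rewrite /spherical_mean_component subr0; split.
- move=> [y [z [[y' [a fa ay] /= yE] [z' fz /= zE] gE]]].
  split; first by exists a.
  by rewrite gE yE zE scale0r add0r scale1r.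
- move=> [[a fa] fg]; have [y ay] : op_dom U a by rewrite domU.
  exists 0, g; split => /=; last by rewrite add0r.
  + by exists y => /=; [exists a|rewrite scale0r].
  + by exists g => //=; rewrite scale1r.
Qed.

Lemma spherical_component1 f g :
  spherical_mean_component 1 A U (f, g) <->
  op_comp U A (f, g) /\ op_dom (op_comp A U) f.
Proof.
rewrite /spherical_mean_component subrr; split.
- move=> [y [z [[y' fy /= yE] [z' fz /= zE] gE]]]; split; last by exists z'.
  by rewrite gE yE zE scale0r addr0 scale1r.
- move=> [fg [z fz]]; exists g, 0; split => /=; last by rewrite addr0.
  + by exists g => //=; rewrite scale1r.
  + by exists z => //=; rewrite scale0r.
Qed.

End spherical_component.

(** * Inclusion of domains *)

Section domain_iff.
Context d (X : measurableType d) (R : realType)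
  (mu : {sigma_finite_measure set X -> \bar R}).
Local Open Scope ereal_scope.

(** A nonnegative weight k is the squared modulus of sqrt k, so that
    [domain_inclusion_bound] applies to the functions |f|^2. *)
Lemma domain_inclusion_iff (a b : X -> \bar R) :
  measurable_fun setT a -> measurable_fun setT b ->
  (forall x, 0 <= a x) -> (forall x, 0 <= b x) ->
  (forall f : L2 mu, \int[mu]_x (sqr_mod f x * a x) < +oo ->
     \int[mu]_x (sqr_mod f x * b x) < +oo) <->
  exists2 c : R, (0 < c)%R & {ae mu, forall x, b x <= c%:E * (1 + a x)}.
Proof.
move=> ma mb a0 b0; have ma1 : measurable_fun setT (fun x => 1 + a x).
  exact: emeasurable_funD.
have a10 x : 0 <= 1 + a x by rewrite adde_ge0.
have split1 (k : X -> \bar R) : measurable_fun setT k -> (forall x, 0 <= k x) ->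
    \int[mu]_x (k x * (1 + a x)) = \int[mu]_x k x + \int[mu]_x (k x * a x).
  move=> mk k0; rewrite -ge0_integralD//.
  - by apply: eq_integral => x _; rewrite ge0_muleDr// mule1.
  - by move=> x _; rewrite mule_ge0.
  - exact: emeasurable_funM.
split=> [ab|[c c0 bc] f fa].
- apply: domain_inclusion_bound => // k mk k0.
  have mEk : measurable_fun setT (EFin \o k) by exact/measurable_EFinP.
  rewrite (split1 (EFin \o k))// => oo.
  have ki0 : 0 <= \int[mu]_x (k x)%:E.
    by apply: integral_ge0 => x _; rewrite lee_fin.
  have kai0 : 0 <= \int[mu]_x ((k x)%:E * a x).
    by apply: integral_ge0 => x _; rewrite mule_ge0 ?lee_fin.
  pose f x := (Num.sqrt (k x))%:C%C.
  have fk x : sqr_mod f x = (k x)%:E by rewrite sqr_mod_real sqr_sqrtr.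
  have mf : cmeasurable f.
    apply: cmeasurable_real.
    by apply: measurable_fun_sqrt.
  have fL : f \in L2fun mu.
    apply/L2funP; split=> //; under eq_integral do rewrite fk.
    by apply: le_lt_trans oo; rewrite leeDl.
  have E (u : X -> \bar R) : measurable_fun setT u ->
      \int[mu]_x (sqr_mod (L2_of mu f) x * u x) = \int[mu]_x ((k x)%:E * u x).
    move=> mu'; apply: ae_eq_integral => //.
    + apply: emeasurable_funM => //.
      exact/measurable_sqr_mod/L2_cmeasurable.
    + exact: emeasurable_funM.
    + by apply: filterS (L2_ofE fL) => x fx _; rewrite -fk /sqr_mod fx.
  rewrite -(E b)//; apply: ab; rewrite E//.
  by apply: le_lt_trans oo; rewrite leeDr.
- have mf := measurable_sqr_mod (L2_cmeasurable f).
  have f0 x : 0 <= sqr_mod f x by exact: sqr_mod_ge0.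
  apply: (@le_lt_trans _ _ (\int[mu]_x (c%:E * (sqr_mod f x * (1 + a x))))).
    apply: ae_ge0_le_integral => //.
    + by move=> x _; rewrite mule_ge0.
    + exact: emeasurable_funM.
    + by move=> x _; rewrite !mule_ge0// lee_fin ltW.
    + by apply: measurable_funeM; exact: emeasurable_funM.
    + by apply: filterS bc => x bx _; rewrite muleCA lee_wpmul2l.
  rewrite ge0_integralZl//; last 3 first.
  + exact: emeasurable_funM.
  + by move=> x _; rewrite mule_ge0.
  + by rewrite lee_fin ltW.
  rewrite split1// lte_mul_pinfty ?lee_fin ?ltW//.
  by apply: lte_add_pinfty => //; exact: L2_lty.
Qed.

End domain_iff.

(** * The endpoint spherical mean transforms *)

Local Close Scope complex_scope.
Local Close Scope quotient_scope.

Theorem corollary16 (d : measure_display) (X : measurableType d) (R : realType)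
    (mu : {sigma_finite_measure set X -> \bar R})
    (phi1 phi2 : {mfun X >-> X}) (w1 w2 : X -> R[i])
    (mw1 : cmeasurable w1) (mw2 : cmeasurable w2)
    (ac1 : pushforward (weighted_measure mu mw1) phi1 `<< mu)
    (ac2 : pushforward (weighted_measure mu mw2) phi2 `<< mu)
    (dd1 : densely_defined (L2_dot mu) (weighted_comp mu phi1 w1))
    (dd2 : densely_defined (L2_dot mu) (weighted_comp mu phi2 w2))
    (A U1 U2 : set (L2 mu * L2 mu))
    (polar : polar_decomposition
       (L2_dot mu) (dot_pair (L2_dot mu))
       (op_column (weighted_comp mu phi1 w1) (weighted_comp mu phi2 w2))
       (op_column U1 U2) A)
    (h1 h2 : X -> \bar R)
    (h1P : is_RN_comp mu phi1 mw1 h1) (h2P : is_RN_comp mu phi2 mw2 h2)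
    (e1 e2 : X -> \bar R)
    (e1P : is_cond_exp mu phi1 mw1 (h1 \+ h2)%E e1)
    (e2P : is_cond_exp mu phi2 mw2 (h1 \+ h2)%E e2)
    (g1 g2 : X -> \bar R)
    (g1P : is_comp_inv mu phi1 mw1 h1 e1 g1)
    (g2P : is_comp_inv mu phi2 mw2 h2 e2 g2)
    (lam : R) (lam01 : lam = 0 \/ lam = 1) :
  let H := (h1 \+ h2)%E in
  let E := (Efun H h1 g1 \+ Efun H h2 g2)%E in
  spherical_mean lam A U1 U2 =
    op_column (weighted_comp mu phi1 (mean_weight lam phi1 w1 H))
              (weighted_comp mu phi2 (mean_weight lam phi2 w2 H))
  <->
  exists2 c : R, 0 < c &
    {ae mu, forall x,
      (1 + H x + E x <= c%:E * (1 + lam%:E * H x + (1 - lam)%:E * E x))%E}.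
Proof.
move=> H E.
have [mh1 h10 _] := h1P; have [mh2 h20 _] := h2P.
have h1fin := densely_defined_fin h1P dd1.
have h2fin := densely_defined_fin h2P dd2.
have [modA isoU kerU TE] := polar.
have AE := column_modulus h1P h2P h1fin h2fin modA.
pose Hr x := fine (h1 x) + fine (h2 x).
rewrite -/Hr in AE.
have mHr : measurable_fun setT Hr.
  by apply: measurable_funD; exact: measurableT_comp.
have Hr0 x : 0 <= Hr x by rewrite addr_ge0// fine_ge0.
have mH : measurable_fun setT H by exact: emeasurable_funD.
have H0 x : (0 <= H x)%E by rewrite adde_ge0.
have HE : {ae mu, forall x, H x = (Hr x)%:E}.
  by apply: filterS2 h1fin h2fin => x f1 f2; rewrite /H /Hr EFinD !fineK.
have h1H : {ae mu, forall x, (h1 x <= (Hr x)%:E)%E}.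
  by apply: filterS HE => x <-; rewrite /H leeDl.
have h2H : {ae mu, forall x, (h2 x <= (Hr x)%:E)%E}.
  by apply: filterS HE => x <-; rewrite /H leeDr.
have [U1E U2E] := polar_isometry_eq h1P h2P mHr Hr0 h1H h2H AE isoU kerU TE.
have domU1 : op_dom U1 = setT.
  by apply/seteqP; split => // f _; rewrite U1E;
    exact: (isometry_part_total h1P mHr Hr0 h1H).
have domU2 : op_dom U2 = setT.
  by apply/seteqP; split => // f _; rewrite U2E;
    exact: (isometry_part_total h2P mHr Hr0 h2H).
have AU1 := modulus_isometry_comp h1P mHr Hr0 HE h1H.
have AU2 := modulus_isometry_comp h2P mHr Hr0 HE h2H.
rewrite -AE -U1E in AU1; rewrite -AE -U2E in AU2.
have UA1 := isometry_modulus_comp h1P h1H.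
have UA2 := isometry_modulus_comp h2P h2H.
rewrite -AE -U1E in UA1; rewrite -AE -U2E in UA2.
have domA := modulus_domP mH mHr Hr0 HE; rewrite -AE in domA.
have dom1 := eta_comp_domP h1P mH H0 mHr Hr0 HE h1H e1P g1P.
have dom2 := eta_comp_domP h2P mH H0 mHr Hr0 HE h2H e2P g2P.
rewrite -AU1 in dom1; rewrite -AU2 in dom2.
pose Eb x := (Efun_version h1 Hr g1 x + Efun_version h2 Hr g2 x)%E.
have mE1 := measurable_Efun_version h1P mHr g1P.
have mE2 := measurable_Efun_version h2P mHr g2P.
have mEb : measurable_fun setT Eb by exact: emeasurable_funD.
have E10 := Efun_version_ge0 h1P Hr0 g1.
have E20 := Efun_version_ge0 h2P Hr0 g2.
have Eb0 x : (0 <= Eb x)%E by rewrite adde_ge0.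
have EE : {ae mu, forall x, E x = Eb x}.
  apply: filterS2 (EfunE h1P Hr0 HE h1H e1P g1P) (EfunE h2P Hr0 HE h2H e2P g2P).
  by move=> x E1 E2; rewrite /E /Eb E1 E2.
have domE (f : L2 mu) : (\int[mu]_x (sqr_mod f x * Eb x) < +oo)%E <->
    op_dom (op_comp A U1) f /\ op_dom (op_comp A U2) f.
  have mf := measurable_sqr_mod (L2_cmeasurable f).
  have i1 : (0 <= \int[mu]_x (sqr_mod f x * Efun_version h1 Hr g1 x))%E.
    by apply: integral_ge0 => x _; rewrite mule_ge0 ?sqr_mod_ge0.
  have i2 : (0 <= \int[mu]_x (sqr_mod f x * Efun_version h2 Hr g2 x))%E.
    by apply: integral_ge0 => x _; rewrite mule_ge0 ?sqr_mod_ge0.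
  rewrite dom1 dom2.
  have -> : (\int[mu]_x (sqr_mod f x * Eb x) = \int[mu]_x
      (sqr_mod f x * Efun_version h1 Hr g1 x +
       sqr_mod f x * Efun_version h2 Hr g2 x))%E.
    by apply: eq_integral => x _; rewrite /Eb ge0_muleDr.
  rewrite ge0_integralD//; last 4 first.
  - by move=> x _; rewrite mule_ge0 ?sqr_mod_ge0.
  - exact: emeasurable_funM.
  - by move=> x _; rewrite mule_ge0 ?sqr_mod_ge0.
  - exact: emeasurable_funM.
  split=> [oo|[? ?]]; last exact: lte_add_pinfty.
  by split; apply: le_lt_trans oo; rewrite ?leeDl ?leeDr.
(* T and its modulus have the same domain *)
have domT (f : L2 mu) : op_dom A f <-> op_dom (op_column
    (weighted_comp mu phi1 w1) (weighted_comp mu phi2 w2)) f.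
  rewrite domA (column_domP h1P h2P h1fin h2fin).
  suff -> : (\int[mu]_x (sqr_mod f x * H x) =
      \int[mu]_x (sqr_mod f x * (Hr x)%:E))%E.
    by [].
  have mf := measurable_sqr_mod (L2_cmeasurable f).
  apply: ae_eq_integral => //; first exact: emeasurable_funM.
    by apply: emeasurable_funM => //; exact/measurable_EFinP.
  by apply: filterS HE => x -> _.
have bound_add (a b : \bar R) (c : R) : (0 <= a)%E -> 0 < c ->
    (b <= c%:E * (1 + a) -> 1 + a + b <= (1 + c)%:E * (1 + a))%E.
  move=> a0 c0 bc; rewrite EFinD ge0_muleDl ?lee_fin ?ler01 ?(ltW c0)// mul1e.
  by rewrite leeD2l.
case: lam01 => ->.
- have W1 : weighted_comp mu phi1 (mean_weight 0 phi1 w1 H) = op_comp A U1.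
    rewrite AU1; apply: weighted_comp_ae; apply: aeW => x.
    by rewrite /mean_weight mul0r addr0.
  have W2 : weighted_comp mu phi2 (mean_weight 0 phi2 w2 H) = op_comp A U2.
    rewrite AU2; apply: weighted_comp_ae; apply: aeW => x.
    by rewrite /mean_weight mul0r addr0.
  rewrite W1 W2.
  transitivity (forall f : L2 mu, (\int[mu]_x (sqr_mod f x * Eb x) < +oo)%E ->
      (\int[mu]_x (sqr_mod f x * H x) < +oo)%E).
    split=> [ME f|sub].
      rewrite domE -domA => -[[g1' fg1] [g2' fg2]].
      have : op_column (op_comp A U1) (op_comp A U2) (f, (g1', g2')) by [].
      by rewrite -ME => -[/= /(spherical_component0 _ _ _ domU1)[]].
    apply/seteqP; split => -[f [p q]] [/=].
      move=> /(spherical_component0 _ _ _ domU1)[_ ?].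
      by move=> /(spherical_component0 _ _ _ domU2)[_ ?].
    move=> fp fq; have fA : op_dom A f.
      by apply/domA/sub/domE; split; [exists p|exists q].
    by split=> /=; apply/spherical_component0.
  rewrite (domain_inclusion_iff mu mEb mH Eb0 H0); split=> -[c c0 cP].
    exists (1 + c); first by rewrite addr_gt0.
    apply: filterS2 EE cP => x -> cx.
    rewrite mul0e adde0 subr0 mul1e.
    by rewrite addeAC; exact: bound_add.
  exists c => //; apply: filterS2 EE cP => x ->.
  rewrite mul0e adde0 subr0 mul1e; apply: le_trans.
  by rewrite addeAC leeDr// adde_ge0.
- have W1 : weighted_comp mu phi1 (mean_weight 1 phi1 w1 H) =
      weighted_comp mu phi1 w1.
    apply: weighted_comp_ae; apply: aeW => x.
    by rewrite /mean_weight mul1r addrC subrK mul1r.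
  have W2 : weighted_comp mu phi2 (mean_weight 1 phi2 w2 H) =
      weighted_comp mu phi2 w2.
    apply: weighted_comp_ae; apply: aeW => x.
    by rewrite /mean_weight mul1r addrC subrK mul1r.
  rewrite W1 W2.
  transitivity (forall f : L2 mu, (\int[mu]_x (sqr_mod f x * H x) < +oo)%E ->
      (\int[mu]_x (sqr_mod f x * Eb x) < +oo)%E).
    split=> [ME f|sub].
      rewrite domE -domA domT => -[[g1' g2'] fg].
      move: fg; rewrite -ME => -[/= /spherical_component1[_ ?]].
      by move=> /spherical_component1[_ ?].
    apply/seteqP; split => -[f [p q]] [/=].
      move=> /spherical_component1[/UA1[_ ?] _].
      by move=> /spherical_component1[/UA2[_ ?] _].
    move=> fp fq; have fA : op_dom A f by apply/domT; exists (p, q).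
    have [d1 d2] := (domE f).1 (sub f ((domA f).1 fA)).
    split=> /=; apply/spherical_component1; split=> //.
      exact/UA1.
    exact/UA2.
  rewrite (domain_inclusion_iff mu mH mEb H0 Eb0); split=> -[c c0 cP].
    exists (1 + c); first by rewrite addr_gt0.
    apply: filterS2 EE cP => x -> cx.
    rewrite subrr mul0e adde0 mul1e.
    exact: bound_add.
  exists c => //; apply: filterS2 EE cP => x ->.
  rewrite subrr mul0e adde0 mul1e; apply: le_trans.
  by rewrite leeDr// adde_ge0.
Qed.
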